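(* The spectrum of the multiplication operator $\mathcal{M}_F$ on $\mathfrak{M}$ is the segment $$\sigma(\mathcal{M}_F)=\Big[-e^{i\pi/4}\tfrac{1}{\sqrt2},\,e^{i\pi/4}\tfrac{1}{\sqrt2}\Big]=\{(1-\tau)(-e^{i\pi/4}/\sqrt2)+\tau e^{i\pi/4}/\sqrt2:\tau\in[0,1]\}.$$
   Context: $\mathbb{R}^{+}=(0,\infty)$. The model space $\mathfrak{M}$ is the Hilbert space of columns $\begin{bmatrix}\varphi_+\\ \varphi_-\end{bmatrix}$ with $\varphi_\pm\in L^2(\mathbb{R}^{+})$, inner product $\langle\varphi_+,\psi_+\rangle_{L^2(\mathbb{R}^{+})}+\langle\varphi_-,\psi_-\rangle_{L^2(\mathbb{R}^{+})}$. For $\mu>0$, $F(\mu)=\begin{bmatrix}0&F_{+-}(\mu)\\ F_{-+}(\mu)&0\end{bmatrix}$ with $F_{+-}(\mu)=\frac{1}{\sqrt{2\pi}}e^{i\pi/4}e^{-\pi\mu/2}\Gamma(\tfrac12+i\mu)$, $F_{-+}(\mu)=\frac{1}{\sqrt{2\pi}}e^{i\pi/4}e^{\pi\mu/2}\Gamma(\tfrac12-i\mu)$ ($\Gamma$ Euler's Gamma function), and $\mathcal{M}_F$ is the bounded operator $(\mathcal{M}_Fy)(\mu)=F(\mu)y(\mu)$ on $\mathfrak{M}$. *)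

(* Defs.v *)
From HB Require Import structures.
From mathcomp Require Import all_boot all_order all_algebra.
From mathcomp Require Import all_classical all_reals all_analysis.
From mathcomp Require Import complex.

Set Implicit Arguments.
Unset Strict Implicit.
Unset Printing Implicit Defensive.

Import Order.TTheory GRing.Theory Num.Theory.
Local Open Scope classical_set_scope.
Local Open Scope ring_scope.
Local Open Scope complex_scope.

Section Defs.
Variable R : realType.
Local Notation C := R[i].
Local Notation leb := (@lebesgue_measure R).

Definition Rpos : set R := `]0, +oo[%classic.

Definition cexp (z : C) : C :=
  (expR (complex.Re z))%:C * (cos (complex.Im z) +i* sin (complex.Im z)).

Definition cpow (t : R) (z : C) : C := cexp ((ln t)%:C * z).

Definition cintegral_pos (f : R -> C) : C :=
  (Rintegral leb Rpos (fun t => complex.Re (f t))) +i* (Rintegral leb Rpos (fun t => complex.Im (f t))).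

(* Euler's Gamma function (integral definition, valid for complex.Re z > 0, which is the
   only case used below: arguments 1/2 +- i mu) *)
Definition Gamma (z : C) : C :=
  cintegral_pos (fun t => cpow t (z - 1) * ((expR (- t))%:C)).

Definition eipi4 : C := cexp (0 +i* (pi / 4%:R)).

Definition Fpm (mu : R) : C :=
  ((Num.sqrt (2%:R * pi))^-1)%:C * eipi4 * (expR (- (pi * mu / 2%:R)))%:C
  * Gamma ((2%:R)^-1 +i* mu).

Definition Fmp (mu : R) : C :=
  ((Num.sqrt (2%:R * pi))^-1)%:C * eipi4 * (expR (pi * mu / 2%:R))%:C
  * Gamma ((2%:R)^-1 +i* (- mu)).

(* Representatives of elements of the model space: pairs (phi_+, phi_-) of
   functions, only their values on R^+ matter. *)
Definition vec := R -> C * C.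

Definition csq (z : C) : R := complex.Re z ^+ 2 + complex.Im z ^+ 2.

Definition cmeasurable (f : R -> C) : Prop :=
  measurable_fun Rpos (fun t => complex.Re (f t)) /\ measurable_fun Rpos (fun t => complex.Im (f t)).

Definition L2pos (f : R -> C) : Prop :=
  cmeasurable f /\ (\int[leb]_(t in Rpos) (csq (f t))%:E < +oo)%E.

Definition inM (y : vec) : Prop := L2pos (fun t => (y t).1) /\ L2pos (fun t => (y t).2).

Definition eqM (y z : vec) : Prop := {ae leb, forall t, Rpos t -> y t = z t}.

Definition normM2 (y : vec) : R :=
  Rintegral leb Rpos (fun t => csq (y t).1 + csq (y t).2).

Definition bounded_opM (T : vec -> vec) : Prop :=
  [/\ (forall y, inM y -> inM (T y)),
      (forall y z, inM y -> inM z -> eqM y z -> eqM (T y) (T z)),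
      (forall (a b : C) y z, inM y -> inM z ->
          eqM (T (fun t => (a * (y t).1 + b * (z t).1, a * (y t).2 + b * (z t).2)))
              (fun t => (a * (T y t).1 + b * (T z t).1, a * (T y t).2 + b * (T z t).2)))
    & exists c : R, forall y, inM y -> normM2 (T y) <= c * normM2 y].

Definition invertibleM (T : vec -> vec) : Prop :=
  exists S, bounded_opM S /\
    (forall y, inM y -> eqM (S (T y)) y /\ eqM (T (S y)) y).

Definition shiftM (T : vec -> vec) (lam : C) : vec -> vec :=
  fun y t => ((T y t).1 - lam * (y t).1, (T y t).2 - lam * (y t).2).

Definition spectrumM (T : vec -> vec) : set C :=
  [set lam | ~ invertibleM (shiftM T lam)].

(* multiplication operator by F = [[0, F_{+-}], [F_{-+}, 0]] *)
Definition MF : vec -> vec :=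
  fun y mu => (Fpm mu * (y mu).2, Fmp mu * (y mu).1).

End Defs.

(* Main.v *)
(** Since F(mu)^2 is the scalar F_{+-}(mu) F_{-+}(mu), which equals
    e^{i pi/2} / (2 cosh (pi mu)) by the reflection formula
    |Gamma(1/2 + i mu)|^2 = pi / cosh (pi mu), the eigenvalues of F(mu) are
    +- e^{i pi/4} (2 cosh (pi mu))^{-1/2}: they fill the segment up to its end
    points and its midpoint, hence give approximate eigenvectors for each of its
    points.  Conversely (F - lam)^{-1} = (F + lam) / (F^2 - lam^2) stays bounded
    off the segment, because the entries of F are bounded by 1.

    The reflection formula is reached without complex analysis.  Put N = n - 1/2.
    The functional equation gives
    |Gamma(N + 1 + i mu)|^2 = prod_(k < n) ((k + 1/2)^2 + mu^2) |Gamma(1/2 + i mu)|^2,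
    and |Gamma(N + 1 + i mu)| / Gamma(N + 1) tends to 1 because the Gamma density
    concentrates around its mean.  So |Gamma(1/2 + i mu)|^2 is
    Gamma(1/2)^2 = pi divided by prod_k (1 + (2 mu / (2k + 1))^2), and this product
    is cosh (pi mu) by the Wallis-type recursion for the integrals of
    cosh (2 mu t) cos^n t over [0, pi/2]. *)

Require Import Defs.
From HB Require Import structures.
From mathcomp Require Import all_boot all_order all_algebra.
From mathcomp Require Import all_classical all_reals all_analysis.
From mathcomp Require Import measurable_realfun.
From mathcomp Require Import complex.
From mathcomp Require Import ring lra.

Set Implicit Arguments.
Unset Strict Implicit.
Unset Printing Implicit Defensive.

Import Order.TTheory GRing.Theory Num.Theory.
Import numFieldNormedType.Exports.
Local Open Scope classical_set_scope.
Local Open Scope ring_scope.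

(** * Calculus on the half-line *)

Section Calculus.
Variable R : realType.
Implicit Types (f g F : R -> R) (a b x : R).
Local Notation mu := (@lebesgue_measure R).

(** This rule and the four after it are phrased for pointwise expressions and plain products, so
    that the derivative of a composite expression is assembled as a term and its value compared by
    [ring]. *)
Lemma is_derive_mul f g x (df dg : R) : is_derive x 1 f df -> is_derive x 1 g dg ->
  is_derive x 1 (fun y => f y * g y) (df * g x + f x * dg).
Proof.
move=> hf hg; have h : is_derive x 1 (f * g) (f x *: dg + g x *: df).
  exact: is_deriveM.
apply: (is_derive_eq h).
by rewrite /GRing.scale /= addrC (mulrC (g x)).
Qed.

Lemma is_derive_add f g x (df dg : R) : is_derive x 1 f df -> is_derive x 1 g dg ->
  is_derive x 1 (fun y => f y + g y) (df + dg).
Proof. by move=> hf hg; exact: is_deriveD. Qed.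

Lemma is_derive_opp f x (df : R) : is_derive x 1 f df ->
  is_derive x 1 (fun y => - f y) (- df).
Proof. by move=> hf; exact: is_deriveN. Qed.

Lemma is_derive_scale f x (df c : R) : is_derive x 1 f df ->
  is_derive x 1 (fun y => c * f y) (c * df).
Proof. by move=> hf; exact: is_deriveZ. Qed.

Lemma is_derive_compose f g x (df dg : R) :
  is_derive x 1 f df -> is_derive (f x) 1 g dg ->
  is_derive x 1 (fun y => g (f y)) (dg * df).
Proof. by move=> hf hg; exact: (is_derive1_comp hg hf). Qed.

Lemma is_derive_continuous f x (df : R) : is_derive x 1 f df -> {for x, continuous f}.
Proof.
by move=> [hf _]; apply/differentiable_continuous/derivable1_diffP.
Qed.

Lemma FTC2_is_derive f F a b : a < b ->
  (forall x, a <= x <= b -> is_derive x 1 F (f x)) ->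
  (forall x, a <= x <= b -> {for x, continuous f}) ->
  (\int[mu]_(x in `[a, b]) (f x)%:E)%E = (F b - F a)%:E.
Proof.
move=> ab dF cf.
have cF x : a <= x <= b -> {for x, continuous F}.
  by move=> /dF; exact: is_derive_continuous.
rewrite (continuous_FTC2 ab (F := F)) ?EFinB//.
- apply/subspace_continuousP => x /=; rewrite in_itv /= => abx.
  by apply: cvg_within_filter; exact: cf.
- split.
  + by move=> x /[!in_itv]/= /andP[ax xb]; case: (dF x) => //; rewrite (ltW ax) (ltW xb).
  + by apply: cvg_at_right_filter; apply: cF; rewrite lexx ltW.
  + by apply: cvg_at_left_filter; apply: cF; rewrite lexx ltW.
- move=> x /[!in_itv]/= /andP[ax xb]; rewrite derive1E.
  by case: (dF x) => //; rewrite (ltW ax) (ltW xb).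
Qed.

Lemma Rintegral_FTC2_is_derive f F a b : a < b ->
  (forall x, a <= x <= b -> is_derive x 1 F (f x)) ->
  (forall x, a <= x <= b -> {for x, continuous f}) ->
  \int[mu]_(x in `[a, b]) f x = F b - F a.
Proof. by move=> ab dF cf; rewrite /Rintegral (FTC2_is_derive ab dF cf). Qed.

Lemma integrable_EFinZl D f c : measurable D -> mu.-integrable D (EFin \o f) ->
  mu.-integrable D (EFin \o (fun t => c * f t)).
Proof. by move=> mD fi; apply: eq_integrable (integrableZl mD c fi). Qed.

Lemma integrable_EFinD D f g : measurable D ->
  mu.-integrable D (EFin \o f) -> mu.-integrable D (EFin \o g) ->
  mu.-integrable D (EFin \o (fun t => f t + g t)).
Proof. by move=> mD fi gi; apply: eq_integrable (integrableD mD fi gi). Qed.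

Lemma integrable_EFinB D f g : measurable D ->
  mu.-integrable D (EFin \o f) -> mu.-integrable D (EFin \o g) ->
  mu.-integrable D (EFin \o (fun t => f t - g t)).
Proof. by move=> mD fi gi; apply: eq_integrable (integrableB mD fi gi). Qed.

Lemma integrable_continuous_itv f a b :
  (forall x, a <= x <= b -> {for x, continuous f}) ->
  mu.-integrable `[a, b] (EFin \o f).
Proof.
move=> cf; apply: continuous_compact_integrable; first exact: segment_compact.
apply/subspace_continuousP => x /=; rewrite in_itv /= => abx.
by apply: cvg_within_filter; exact: cf.
Qed.

(** * Improper integrals over the half-line *)

Lemma measurable_Rpos : measurable (@Rpos R).
Proof. exact: measurable_itv. Qed.
#[local] Hint Resolve measurable_Rpos : core.

Lemma measurable_fun_continuous_Rpos f :
  (forall x, 0 < x -> {for x, continuous f}) -> measurable_fun (@Rpos R) f.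
Proof.
move=> cf; apply: open_continuous_measurable_fun.
  exact: interval_open.
by move=> x /[!inE]/=; rewrite /Rpos /= in_itv/= andbT; exact: cf.
Qed.

(** Compact exhaustion of the half-line. The shift by 2 keeps the left end below 1 and the right end
    above it, so that no interval degenerates and the fundamental theorem applies to each. *)
Let W (n : nat) : set R := `[(n.+2%:R)^-1, n.+2%:R]%classic.

Let W_nondecreasing : nondecreasing_seq W.
Proof.
move=> m n mn; apply/subsetPset => x; rewrite /W /= !in_itv /= => /andP[mx xm].
apply/andP; split.
  by apply: le_trans mx; rewrite lef_pV2 ?posrE ?ltr0n// ler_nat !ltnS.
by apply: (le_trans xm); rewrite ler_nat !ltnS.
Qed.

Let bigcup_W : \bigcup_n W n = @Rpos R.
Proof.
apply/seteqP; split => x /=.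
  move=> [n _] /=; rewrite /W /Rpos /= !in_itv /= => /andP[nx _].
  by rewrite (lt_le_trans _ nx)// invr_gt0 ltr0n.
rewrite /Rpos /= in_itv /= andbT => x0.
(* The sum dominates both x and 1 / x, so one integer serves for both ends. *)
have [n xn] : exists n : nat, x + x^-1 <= n%:R.
  by exists (Num.bound (x + x^-1)); rewrite ltW// archi_boundP// addr_ge0// ?invr_ge0 ltW.
exists n => //; rewrite /W /= in_itv /=.
have nn : n%:R <= n.+2%:R :> R by rewrite ler_nat -addn2 leq_addr.
have xV : 0 < x^-1 by rewrite invr_gt0.
apply/andP; split; last lra.
by rewrite -[x]invrK lef_pV2 ?posrE ?ltr0n ?invr_gt0//; lra.
Qed.

Let W_Rpos n : W n `<=` @Rpos R.
Proof. by rewrite -bigcup_W; exact: bigcup_sup. Qed.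

(** The fundamental theorem on each [W n], followed by the limits of F along the sequences n + 2 and
    1 / (n + 2). [integral_Rpos_ge0] and [Rintegral_Rpos] differ in how they pass from [W n] to the
    union. *)
Let integral_W f F (l0 l1 : R) :
  (forall x, 0 < x -> is_derive x 1 F (f x)) ->
  (forall x, 0 < x -> {for x, continuous f}) ->
  F x @[x --> 0^'+] --> l0 -> F x @[x --> +oo] --> l1 ->
  (\int[mu]_(x in W n) (f x)%:E)%E @[n --> \oo] --> (l1 - l0)%:E.
Proof.
move=> dF cf F0 F1.
have W0 n x : ((n.+2%:R)^-1 : R) <= x -> 0 < x.
  by move=> nx; rewrite (lt_le_trans _ nx)// invr_gt0 ltr0n.
have -> : (fun n => (\int[mu]_(x in W n) (f x)%:E)%E) =
          EFin \o (fun n => F n.+2%:R - F (n.+2%:R)^-1).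
  apply/funext => n /=; apply: FTC2_is_derive.
  - rewrite (@le_lt_trans _ _ 1)//.
      by rewrite invf_le1 ?ltr0n// ler1n.
    by rewrite ltr1n.
  - by move=> x /andP[/W0 x0 _]; exact: dF.
  - by move=> x /andP[/W0 x0 _]; exact: cf.
apply: cvg_EFin; first exact: nearW.
have cvgy : (n.+2%:R : R) @[n --> \oo] --> +oo.
  by have := @cvgr_idn R; rewrite -(cvg_shiftn 2); under eq_fun do rewrite addn2.
apply: cvgB.
  exact: (((cvg_pinftyP F l1).1 F1) (fun n => n.+2%:R)).
apply: (((cvg_at_rightP F 0 l0).1 F0) (fun n => (n.+2%:R)^-1)).
split; first by move=> n; rewrite invr_gt0 ltr0n.
apply: (gtr0_cvgV0 _).2 cvgy.
by apply: nearW => n; rewrite ltr0n.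
Qed.

(** Monotone convergence along [W]. The extended integral is kept so that its finite value can prove
    integrability in the next lemma. *)
Lemma integral_Rpos_ge0 f F (l0 l1 : R) :
  (forall x, 0 < x -> 0 <= f x) ->
  (forall x, 0 < x -> is_derive x 1 F (f x)) ->
  (forall x, 0 < x -> {for x, continuous f}) ->
  F x @[x --> 0^'+] --> l0 -> F x @[x --> +oo] --> l1 ->
  (\int[mu]_(x in @Rpos R) (f x)%:E)%E = (l1 - l0)%:E.
Proof.
move=> f0 dF cf F0 F1.
have mf : measurable_fun (@Rpos R) f by exact: measurable_fun_continuous_Rpos.
apply/esym/(cvg_unique _ (integral_W dF cf F0 F1)) => //.
rewrite -bigcup_W; apply: ge0_nondecreasing_set_cvg_integral => //.
- by move=> i; exact: measurable_itv.
- move=> i; apply/measurable_EFinP; apply: measurable_funS mf => //.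
- move=> i x /W_Rpos; rewrite /Rpos /= in_itv /= andbT => x0.
  by rewrite lee_fin f0.
Qed.

Lemma integrable_Rpos_ge0 f F (l0 l1 : R) :
  (forall x, 0 < x -> 0 <= f x) ->
  (forall x, 0 < x -> is_derive x 1 F (f x)) ->
  (forall x, 0 < x -> {for x, continuous f}) ->
  F x @[x --> 0^'+] --> l0 -> F x @[x --> +oo] --> l1 ->
  mu.-integrable (@Rpos R) (EFin \o f).
Proof.
move=> f0 dF cf F0 F1; apply/integrableP; split.
  by apply/measurable_EFinP; exact: measurable_fun_continuous_Rpos.
under eq_integral.
  move=> x /[!inE]; rewrite /Rpos /= in_itv /= andbT => x0.
  rewrite ger0_norm ?f0//; over.
by rewrite (integral_Rpos_ge0 f0 dF cf F0 F1) ltry.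
Qed.

(** For an integrand of varying sign, monotone convergence is applied to the positive and negative
    parts; integrability makes the difference of the two limits meaningful. *)
Lemma Rintegral_Rpos f F (l0 l1 : R) :
  mu.-integrable (@Rpos R) (EFin \o f) ->
  (forall x, 0 < x -> is_derive x 1 F (f x)) ->
  (forall x, 0 < x -> {for x, continuous f}) ->
  F x @[x --> 0^'+] --> l0 -> F x @[x --> +oo] --> l1 ->
  \int[mu]_(x in @Rpos R) f x = l1 - l0.
Proof.
move=> fi dF cf F0 F1.
suff : (\int[mu]_(x in W n) (f x)%:E)%E @[n --> \oo] -->
    (\int[mu]_(x in @Rpos R) (f x)%:E)%E.
  by move=> /(cvg_unique _ (integral_W dF cf F0 F1)) h; rewrite /Rintegral -h.
have fm := measurable_int _ fi.
under eq_fun do rewrite integralE.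
rewrite integralE; apply: cvgeB.
- apply: fin_num_adde_defr; rewrite ge0_fin_numE ?integral_ge0//.
  exact: integral_funepos_lt_pinfty.
- rewrite -bigcup_W; apply: ge0_nondecreasing_set_cvg_integral => //.
  + by move=> i; exact: measurable_itv.
  + move=> i; apply: measurable_funS (measurable_funepos fm) => //.
- rewrite -bigcup_W; apply: ge0_nondecreasing_set_cvg_integral => //.
  + by move=> i; exact: measurable_itv.
  + move=> i; apply: measurable_funS (measurable_funeneg fm) => //.
Qed.

End Calculus.

(** * The infinite product of cosh *)

Section CoshProduct.
Variable R : realType.
Implicit Types (x t b : R) (f df : R -> R).
Local Notation mu := (@lebesgue_measure R).

(** By the mean value theorem; most of the elementary inequalities below are reduced to it. *)
Lemma le_is_derive_ge0 f df a b : a <= b ->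
  (forall x, a <= x <= b -> is_derive x 1 f (df x)) ->
  (forall x, a <= x <= b -> 0 <= df x) -> f a <= f b.
Proof.
move=> ab dfE df0.
have [| |c /[!in_itv]/= cab] := @MVT_segment R f df a b ab.
- by move=> x /[!in_itv]/= /andP[ax xb]; apply: dfE; rewrite !ltW.
- apply/subspace_continuousP => x /=; rewrite in_itv /= => abx.
  by apply: cvg_within_filter; apply: is_derive_continuous (dfE _ abx).
by rewrite -subr_ge0 => ->; rewrite mulr_ge0 ?df0 ?subr_ge0.
Qed.

(** * Hyperbolic functions *)

Definition coshR x : R := (expR x + expR (- x)) / 2.
Definition sinhR x : R := (expR x - expR (- x)) / 2.

Lemma is_derive_expRN x : is_derive x 1 (fun y => expR (- y)) (- expR (- x)).
Proof.
have := is_derive_compose (is_derive_opp (is_derive_id x 1)) (is_derive_expR (- x)).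
by rewrite mulrN1.
Qed.

Lemma is_derive_coshR x : is_derive x 1 coshR (sinhR x).
Proof.
have h := is_derive_scale 2^-1 (is_derive_add (is_derive_expR x) (is_derive_expRN x)).
rewrite /coshR; under eq_fun do rewrite mulrC.
by apply: is_derive_eq h _; rewrite /sinhR mulrC.
Qed.

Lemma is_derive_sinhR x : is_derive x 1 sinhR (coshR x).
Proof.
have h := is_derive_scale 2^-1
  (is_derive_add (is_derive_expR x) (is_derive_opp (is_derive_expRN x))).
rewrite /sinhR; under eq_fun do rewrite mulrC.
by apply: is_derive_eq h _; rewrite /coshR opprK mulrC.
Qed.

(** With u = exp (x / 2), cosh x - 1 is (u - 1 / u)^2 / 2. *)
Lemma coshR_ge1 x : 1 <= coshR x.
Proof.
rewrite /coshR -(@ler_pM2r _ 2)// mul1r divfK//.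
have := expR_gt0 (x/2); set u := expR (x/2) => u0.
have -> : expR x = u ^+ 2 by rewrite -expRM_natr; congr expR; lra.
have -> : expR (- x) = u ^- 2.
  by rewrite -expRM_natr -expRN; congr expR; lra.
have uu : u * u^-1 = 1 by rewrite divff// gt_eqF.
rewrite -exprVn; have := sqr_ge0 (u - u^-1); nra.
Qed.

(** The same square, now with u - 1 / u = u (1 - exp (- x)) <= x u. *)
Lemma coshR_sub1_le x : 0 <= x -> coshR x - 1 <= x ^+ 2 / 2 * expR x.
Proof.
move=> x0; have := expR_gt0 (x/2); set u := expR (x/2) => u0.
have eu : expR x = u ^+ 2 by rewrite -expRM_natr; congr expR; lra.
have eV : expR (- x) = u ^- 2.
  by rewrite -expRM_natr -expRN; congr expR; lra.
have uu : u * u^-1 = 1 by rewrite divff// gt_eqF.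
rewrite /coshR eV eu -exprVn.
have h : u^-1 ^+ 2 >= 1 - x.
  by rewrite exprVn -eV; have := expR_ge1Dx (- x); lra.
have V0 : 0 < u^-1 by rewrite invr_gt0.
have h1 : u - u^-1 <= x * u by nra.
have h2 : 0 <= u - u^-1.
  have : 1 <= u by rewrite /u; have := expR_ge1Dx (x/2); lra.
  nra.
have : (u - u^-1) ^+ 2 <= (x * u) ^+ 2 by rewrite lerXn2r// nnegrE; nra.
nra.
Qed.

Lemma mul_cos_le_sin t : 0 <= t <= pi / 2 -> t * cos t <= sin t.
Proof.
move=> /andP[t0 tp].
have := @le_is_derive_ge0 (fun y => sin y + - (y * cos y)) (fun y => y * sin y) 0 t t0.
rewrite sin0 mul0r subr0 subr_ge0; apply.
  move=> x _.
  have h := is_derive_add (is_derive_sin x)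
    (is_derive_opp (is_derive_mul (is_derive_id x 1) (is_derive_cos x))).
  apply: (is_derive_eq h); ring.
move=> x /andP[x0 xt]; rewrite mulr_ge0// sin_ge0_pi// x0/=.
by have := @pi_gt0 R; lra.
Qed.

(** The Wallis integral weighted by cosh (b t). Its recursion in n yields the factors of the
    product, while the weight ceases to matter for large n because cos^n concentrates at 0, where
    the weight is 1. *)
Definition wallis b n : R :=
  \int[mu]_(t in `[0, pi / 2]) (coshR (b * t) * cos t ^+ n).

Lemma is_derive_coshRM b t : is_derive t 1 (fun y => coshR (b * y)) (b * sinhR (b * t)).
Proof.
have h := is_derive_compose (is_derive_scale b (is_derive_id t 1)) (is_derive_coshR (b * t)).
by apply: (is_derive_eq h); ring.
Qed.

Lemma is_derive_sinhRM b t : is_derive t 1 (fun y => sinhR (b * y)) (b * coshR (b * t)).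
Proof.
have h := is_derive_compose (is_derive_scale b (is_derive_id t 1)) (is_derive_sinhR (b * t)).
by apply: (is_derive_eq h); ring.
Qed.

Lemma is_derive_expn f t (df : R) n : is_derive t 1 f df ->
  is_derive t 1 (fun y => f y ^+ n) (n%:R * f t ^+ n.-1 * df).
Proof.
move=> h; elim: n => [|n IH].
  apply: (is_derive_eq (is_derive_cst (1 : R) t 1)); by rewrite !mul0r.
under eq_fun do rewrite exprS.
apply: (is_derive_eq (is_derive_mul h IH)).
case: n {IH} => [|n] /=; first by rewrite expr0; ring.
by rewrite -[n.+2%:R]natr1 exprS; ring.
Qed.

Lemma continuous_wallis b n t :
  {for t, continuous (fun t => coshR (b * t) * cos t ^+ n)}.
Proof.
apply: continuousM; first exact: is_derive_continuous (is_derive_coshRM b t).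
exact: is_derive_continuous (is_derive_expn n (is_derive_cos t)).
Qed.

Lemma integrable_wallis b n :
  mu.-integrable `[0, pi / 2] (EFin \o (fun t => coshR (b * t) * cos t ^+ n)).
Proof. by apply: integrable_continuous_itv => x _; exact: continuous_wallis. Qed.

Lemma wallis_rec b n :
  (n.+2%:R ^+ 2 + b ^+ 2) * wallis b n.+2 = n.+2%:R * n.+1%:R * wallis b n.
Proof.
rewrite /wallis -!RintegralZl//; try exact: integrable_wallis.
have iZ c m : mu.-integrable `[0, pi / 2]
    (EFin \o (fun t => c * (coshR (b * t) * cos t ^+ m))).
  apply: integrable_continuous_itv => x _; apply: continuousM.
    exact: cst_continuous.
  exact: continuous_wallis.
apply/eqP; rewrite -subr_eq0 -RintegralB//; apply/eqP.
(* The integrand of the difference is the derivative of F, which vanishes at both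
   ends because n + 1 > 0. *)
pose F t := b * (sinhR (b * t) * cos t ^+ n.+2)
  + n.+2%:R * (coshR (b * t) * (cos t ^+ n.+1 * sin t)).
transitivity (F (pi / 2) - F 0); last first.
  rewrite /F /= cos_pihalf sin0 !expr0n/= !mulr0 !mul0r !mulr0 addr0.
  by rewrite /sinhR oppr0 subrr !mul0r !mulr0 addr0 subrr.
apply: Rintegral_FTC2_is_derive.
- by have := @pi_gt0 R; lra.
- move=> t _.
  have h := is_derive_add
    (is_derive_scale b (is_derive_mul (is_derive_sinhRM b t)
      (is_derive_expn n.+2 (is_derive_cos t))))
    (is_derive_scale n.+2%:R (is_derive_mul (is_derive_coshRM b t)
      (is_derive_mul (is_derive_expn n.+1 (is_derive_cos t)) (is_derive_sin t)))).
  apply: (is_derive_eq h).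
  have := cos2Dsin2 t; set c := cos t; set s := sin t => cs.
  (* Replacing sin^2 by 1 - cos^2 leaves only the powers n and n + 2 of the cosine. *)
  have -> : n.+1%:R * c ^+ n.+1.-1 * - s * s = - n.+1%:R * c ^+ n * (1 - c ^+ 2).
    by rewrite -cs /=; ring.
  by rewrite !(exprS c) -[n.+2%:R]natr1 /=; ring.
- move=> t _; apply: continuousB; apply: continuousM;
    try exact: cst_continuous; exact: continuous_wallis.
Qed.

(** The integration by parts of [wallis_rec] at exponent 1. The factor cos^0 does not vanish at pi /
    2, and the surviving boundary term is the limit of the product. *)
Lemma wallis1 b : (1 + b ^+ 2) * wallis b 1 = coshR (b * (pi / 2)).
Proof.
rewrite /wallis -!RintegralZl//; last exact: integrable_wallis.
pose F t := coshR (b * t) * sin t + b * (sinhR (b * t) * cos t).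
transitivity (F (pi / 2) - F 0); last first.
  rewrite /F /= cos_pihalf sin_pihalf sin0 /sinhR !mulr0 oppr0 subrr.
  by rewrite !mul0r !mulr0 mulr1 !addr0 subr0.
apply: Rintegral_FTC2_is_derive.
- by have := @pi_gt0 R; lra.
- move=> t _.
  have h := is_derive_add
    (is_derive_mul (is_derive_coshRM b t) (is_derive_sin t))
    (is_derive_scale b (is_derive_mul (is_derive_sinhRM b t) (is_derive_cos t))).
  by apply: (is_derive_eq h); ring.
- move=> t _; apply: continuousM; first exact: cst_continuous.
  exact: continuous_wallis.
Qed.

Lemma coshR0 : coshR 0 = 1 :> R.
Proof. by rewrite /coshR oppr0 expR0 -mulr2n divff. Qed.

Lemma wallis01 : wallis 0 1 = 1.
Proof.
by have := wallis1 0; rewrite expr0n /= addr0 !mul1r mul0r coshR0.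
Qed.

(** The recursion at b = 0 has positive coefficients and carries strict positivity up from
    [wallis01]; these integrals serve as lower bounds for denominators later. *)
Lemma wallis0_odd_gt0 m : 0 < wallis 0 m.*2.+1.
Proof.
elim: m => [|m IH].
  by rewrite wallis01.
have := wallis_rec 0 m.*2.+1; rewrite expr0n /= addr0 doubleS => h.
by rewrite -(pmulr_rgt0 _ (x := m.*2.+3%:R ^+ 2)) ?h ?exprn_gt0 ?mulr_gt0 ?ltr0n.
Qed.

Lemma wallis_ge b n : wallis 0 n <= wallis b n.
Proof.
apply: le_Rintegral => //; try exact: integrable_wallis.
move=> t /=; rewrite in_itv /= => /andP[t0 tp]; rewrite mul0r.
rewrite ler_wpM2r ?exprn_ge0 ?cos_ge0_pihalf//.
  by rewrite tp andbT; have := @pi_gt0 R; lra.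
by rewrite coshR0 coshR_ge1.
Qed.

(* cosh (b t) - 1 <= C t^2 and t cos t <= sin t, so the excess over b = 0 is at most
   C times the integral of sin^2 cos^n, which the recursion at b = 0 evaluates. *)
Lemma wallis_le b n : 0 <= b ->
  wallis b n.+2 <=
  (1 + b ^+ 2 / 2 * expR (b * (pi / 2)) / n.+1%:R) * wallis 0 n.+2.
Proof.
move=> b0; set C := b ^+ 2 / 2 * expR (b * (pi / 2)).
have C0 : 0 <= C by rewrite mulr_ge0 ?expR_ge0// divr_ge0// sqr_ge0.
have n0 : 0 < n.+1%:R :> R by rewrite ltr0n.
have -> : (1 + C / n.+1%:R) * wallis 0 n.+2 =
    wallis 0 n.+2 + C * (wallis 0 n - wallis 0 n.+2).
  have := wallis_rec 0 n; rewrite expr0n /= addr0 expr2 -!mulrA => /mulfI.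
  rewrite pnatr_eq0 => /(_ isT) h.
  have -> : wallis 0 n = n.+2%:R * wallis 0 n.+2 / n.+1%:R.
    by rewrite h mulrC mulKf ?gt_eqF.
  rewrite -[n.+2%:R]natr1; field; rewrite gt_eqF//.
have iZ : mu.-integrable `[0, pi / 2] (EFin \o (fun t =>
    C * (coshR (0 * t) * cos t ^+ n - coshR (0 * t) * cos t ^+ n.+2))).
  apply: integrable_continuous_itv => x _; apply: continuousM.
    exact: cst_continuous.
  by apply: continuousB; exact: continuous_wallis.
have iB : mu.-integrable `[0, pi / 2] (EFin \o (fun t =>
    coshR (0 * t) * cos t ^+ n - coshR (0 * t) * cos t ^+ n.+2)).
  apply: integrable_continuous_itv => x _.
  by apply: continuousB; exact: continuous_wallis.
rewrite -RintegralB//; try exact: integrable_wallis.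
rewrite -RintegralZl// -RintegralD//; try exact: integrable_wallis.
apply: le_Rintegral => //; first exact: integrable_wallis.
  apply: integrable_continuous_itv => x _; apply: continuousD.
    exact: continuous_wallis.
  apply: continuousM; first exact: cst_continuous.
  by apply: continuousB; exact: continuous_wallis.
move=> t /=; rewrite in_itv /= => /andP[t0 tp]; rewrite mul0r coshR0.
have tp' : 0 <= t <= pi / 2 by rewrite t0 tp.
have ct : 0 <= cos t.
  by apply: cos_ge0_pihalf; rewrite tp andbT; have := @pi_gt0 R; lra.
have h : coshR (b * t) - 1 <= C * t ^+ 2.
  apply: (le_trans (coshR_sub1_le (mulr_ge0 b0 t0))).
  rewrite exprMn (_ : C * _ = (b ^+ 2 * t ^+ 2 / 2) * expR (b * (pi / 2))).
    by rewrite ler_wpM2l ?divr_ge0 ?mulr_ge0 ?sqr_ge0// ler_expR ler_wpM2l.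
  by rewrite /C; ring.
have h2 : (t * cos t) ^+ 2 <= 1 - cos t ^+ 2.
  by rewrite -sin2cos2 lerXn2r ?nnegrE ?mul_cos_le_sin ?mulr_ge0//
    (le_trans _ (mul_cos_le_sin tp')) ?mulr_ge0.
have cn : 0 <= cos t ^+ n by rewrite exprn_ge0.
rewrite !exprS.
have -> : coshR (b * t) * (cos t * (cos t * cos t ^+ n)) =
  (1 + (coshR (b * t) - 1)) * cos t ^+ 2 * cos t ^+ n by ring.
have -> : 1 * (cos t * (cos t * cos t ^+ n)) + C * (1 * cos t ^+ n
   - 1 * (cos t * (cos t * cos t ^+ n))) =
   (cos t ^+ 2 + C * (1 - cos t ^+ 2)) * cos t ^+ n by ring.
apply: ler_wpM2r => //.
rewrite mulrDl mul1r lerD2l; apply: (@le_trans _ _ (C * t ^+ 2 * cos t ^+ 2)).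
  by rewrite ler_wpM2r ?sqr_ge0.
by rewrite -mulrA -exprMn ler_wpM2l.
Qed.

(** Dividing the recursion at b by the one at 0 shows that the ratio of the two integrals loses the
    factor 1 + (b / (n + 2))^2 from n to n + 2. The product telescopes down to [wallis1]. *)
Lemma wallis_prod b m :
  wallis b m.*2.+1 * \prod_(k < m.+1) (1 + (b / k.*2.+1%:R) ^+ 2) =
  coshR (b * (pi / 2)) * wallis 0 m.*2.+1.
Proof.
elim: m => [|m IH].
  by rewrite big_ord_recr big_ord0 /= mul1r divr1 wallis01 mulr1 -wallis1 mulrC.
rewrite doubleS big_ord_recr.
have h := wallis_rec b m.*2.+1.
have := wallis_rec 0 m.*2.+1; rewrite expr0n /= addr0 => h0.
set p := \prod_(i < _) _ in IH *.
have n1 : m.*2.+3%:R != 0 :> R by rewrite pnatr_eq0.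
have -> : wallis 0 m.*2.+3 = m.*2.+3%:R * m.*2.+2%:R * wallis 0 m.*2.+1 / m.*2.+3%:R ^+ 2.
  by rewrite -h0 mulrC mulKf// expf_neq0.
have -> : wallis b m.*2.+3 * (p * (1 + (b / m.*2.+3%:R) ^+ 2)) =
  ((m.*2.+3%:R ^+ 2 + b ^+ 2) * wallis b m.*2.+3) * p / m.*2.+3%:R ^+ 2.
  by field.
rewrite h (_ : _ / _ = m.*2.+3%:R * m.*2.+2%:R / m.*2.+3%:R ^+ 2 *
  (wallis b m.*2.+1 * p)); last by field.
by rewrite IH; field.
Qed.

(** By [wallis_prod] the product is cosh (b pi / 2) times the ratio of the integrals at 0 and at b,
    which lies between 1 / (1 + C / (m + 1)) and 1. There are m + 2 factors because [wallis_le]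
    needs an index of the form n + 2, here 2 m + 3. *)
Lemma coshR_prod b : 0 <= b ->
  \prod_(k < m.+2) (1 + (b / k.*2.+1%:R) ^+ 2) @[m --> \oo] --> coshR (b * (pi / 2)).
Proof.
move=> b0; set C := b ^+ 2 / 2 * expR (b * (pi / 2)).
have C0 : 0 <= C by rewrite mulr_ge0 ?expR_ge0// divr_ge0// sqr_ge0.
have ch0 : 0 < coshR (b * (pi / 2)) by rewrite (lt_le_trans ltr01)// coshR_ge1.
apply: (@squeeze_cvgr _ _ _ _ (fun m => coshR (b * (pi / 2)) * (1 + C * (m.+1%:R)^-1)^-1)
  (fun=> coshR (b * (pi / 2)))); last exact: cvg_cst.
  apply: nearW => m.
  have w0 := wallis0_odd_gt0 m.+1.
  have wb : 0 < wallis b m.+1.*2.+1 by rewrite (lt_le_trans w0)// wallis_ge.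
  have -> : \prod_(k < m.+2) (1 + (b / k.*2.+1%:R) ^+ 2) =
      coshR (b * (pi / 2)) * (wallis 0 m.+1.*2.+1 / wallis b m.+1.*2.+1).
    by rewrite mulrA -wallis_prod mulrC mulKf// gt_eqF.
  apply/andP; split.
    rewrite ler_pM2l// ler_pdivlMr// ler_pdivrMl; last first.
      by rewrite ltr_wpDr// mulr_ge0// invr_ge0.
    apply: (le_trans (wallis_le m.*2.+1 b0)); rewrite -/C.
    rewrite doubleS in w0 *; rewrite ler_wpM2r ?(ltW w0)// lerD2l ler_wpM2l//.
    rewrite lef_pV2 ?posrE ?ltr0n//.
    by rewrite ler_nat ltnS leqW// -addnn leq_addr.
  by rewrite ler_piMr ?(ltW ch0)// ler_pdivrMr// mul1r wallis_ge.
have h : 1 + C * (m.+1%:R)^-1 @[m --> \oo] --> 1 + C * 0.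
  apply: cvgD; first exact: cvg_cst.
  by apply: cvgM; [exact: cvg_cst|exact: cvg_harmonic].
rewrite mulr0 addr0 in h.
have := cvgM (cvg_cst (coshR (b * (pi / 2)))) (cvgV (oner_neq0 _) h).
by rewrite invr1 mulr1; apply.
Qed.

End CoshProduct.

(** * The Gamma integral on vertical lines *)

Section GammaCriticalLine.
Variable R : realType.
Implicit Types (x t a m : R).
Local Notation mu := (@lebesgue_measure R).
Local Notation Rpos := (@Rpos R).

(** * Elementary inequalities *)

Lemma sin_le_id x : 0 <= x -> sin x <= x.
Proof.
move=> x0.
have := @le_is_derive_ge0 R (fun y => y + - sin y) (fun y => 1 - cos y) 0 x x0.
rewrite sin0 oppr0 addr0 subr_ge0; apply.
by move=> y _; rewrite subr_ge0 cos_le1.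
Qed.

Lemma cos_ge x : 1 - x ^+ 2 / 2 <= cos x.
Proof.
rewrite -cos_norm -[x ^+ 2]real_normK ?num_real//.
move: `|x| (normr_ge0 x) => {}x x0.
have := @le_is_derive_ge0 R (fun y => cos y + 2^-1 * (y * y)) (fun y => y - sin y) 0 x x0.
rewrite cos0 mul0r mulr0 addr0 => h.
suff : 1 <= cos x + 2^-1 * (x * x) by rewrite expr2; lra.
apply: h; last by move=> y /andP[y0 _]; rewrite subr_ge0 sin_le_id.
move=> y _; have h := is_derive_add (is_derive_cos y)
  (is_derive_scale 2^-1 (is_derive_mul (is_derive_id y 1) (is_derive_id y 1))).
by apply: (is_derive_eq h); field.
Qed.

Lemma sinhR0 : sinhR 0 = 0 :> R.
Proof. by rewrite /sinhR oppr0 subrr mul0r. Qed.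

Lemma sinhR_ge x : 0 <= x -> x <= sinhR x.
Proof.
move=> x0.
have := @le_is_derive_ge0 R (fun y => sinhR y + - y) (fun y => coshR y + - 1) 0 x x0.
rewrite sinhR0 oppr0 addr0 subr_ge0; apply.
  move=> y _; have h := is_derive_add (is_derive_sinhR y) (is_derive_opp (is_derive_id y 1)).
  exact: (is_derive_eq h).
by move=> y _; rewrite subr_ge0 coshR_ge1.
Qed.

(** Both sides are even, and for x >= 0 their difference has derivative 2 (sinh x - x). This trades
    x^2 for exponentials of x, whose integrals against the Gamma density are known. *)
Lemma sqr_le_coshR x : x ^+ 2 <= 2 * (coshR x - 1).
Proof.
wlog x0 : x / 0 <= x => [hw|].
  have [/hw//|/ltW xn] := leP 0 x.
  have := hw (- x); rewrite oppr_ge0 sqrrN /coshR opprK [expR (- x) + _]addrC; exact.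
have := @le_is_derive_ge0 R (fun y => 2 * coshR y + - (y * y))
  (fun y => 2 * (sinhR y - y)) 0 x x0.
rewrite mul0r oppr0 addr0 coshR0 mulr1 expr2 => h.
suff : 2 <= 2 * coshR x - x * x by lra.
apply: h; last by move=> y /andP[y0 _]; rewrite mulr_ge0// subr_ge0 sinhR_ge.
move=> y _; have h := is_derive_add (is_derive_scale 2 (is_derive_coshR y))
  (is_derive_opp (is_derive_mul (is_derive_id y 1) (is_derive_id y 1))).
by apply: (is_derive_eq h); ring.
Qed.

(* The substitution t^z = exp (z ln t) splits the integrand of Gamma(a + 1 + i m)
   into its real and imaginary parts, so that Gamma(a + 1 + i m) = Gc a m + i Gs a m:
   the parameter a is the exponent, one less than the argument of Gamma. *)
Definition gker a t := expR (a * ln t - t).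
Definition gcos a m t := gker a t * cos (m * ln t).
Definition gsin a m t := gker a t * sin (m * ln t).
Definition Gc a m := \int[mu]_(t in Rpos) gcos a m t.
Definition Gs a m := \int[mu]_(t in Rpos) gsin a m t.

Lemma gker_sub1 a t : 0 < t -> gker (a - 1) t = gker a t / t.
Proof.
move=> t0; rewrite /gker -[X in _ / X]lnK ?posrE// -expRB; congr expR; ring.
Qed.

Lemma is_derive_lnM a t : 0 < t -> is_derive t 1 (fun y => a * ln y) (a / t).
Proof. by move=> t0; exact: is_derive_scale (is_derive1_ln t0). Qed.

Lemma is_derive_gker a t : 0 < t ->
  is_derive t 1 (gker a) (a * gker (a - 1) t - gker a t).
Proof.
move=> t0; have h := is_derive_compose
  (is_derive_add (is_derive_lnM a t0) (is_derive_opp (is_derive_id t 1)))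
  (is_derive_expR (a * ln t - t)).
apply: (is_derive_eq h); rewrite gker_sub1// /gker; ring.
Qed.

(** Real part of the derivative of t^(a + i m) e^(-t); [is_derive_gsin] is the imaginary part.
    Integrated over the half-line they become the functional equation. *)
Lemma is_derive_gcos a m t : 0 < t ->
  is_derive t 1 (gcos a m) (a * gcos (a - 1) m t - m * gsin (a - 1) m t - gcos a m t).
Proof.
move=> t0; have h := is_derive_mul (is_derive_gker a t0)
  (is_derive_compose (is_derive_lnM m t0) (is_derive_cos (m * ln t))).
apply: (is_derive_eq h); rewrite /gcos /gsin !gker_sub1//; ring.
Qed.

Lemma is_derive_gsin a m t : 0 < t ->
  is_derive t 1 (gsin a m) (a * gsin (a - 1) m t + m * gcos (a - 1) m t - gsin a m t).
Proof.
move=> t0; have h := is_derive_mul (is_derive_gker a t0)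
  (is_derive_compose (is_derive_lnM m t0) (is_derive_sin (m * ln t))).
apply: (is_derive_eq h); rewrite /gcos /gsin !gker_sub1//; ring.
Qed.

Lemma gcos_le a m t : `|gcos a m t| <= gker a t.
Proof.
by rewrite normrM ger0_norm ?expR_ge0// ler_piMr ?expR_ge0// cos_max.
Qed.

Lemma gsin_le a m t : `|gsin a m t| <= gker a t.
Proof.
by rewrite normrM ger0_norm ?expR_ge0// ler_piMr ?expR_ge0// sin_max.
Qed.

(** From ln u <= u at u = t / (2 a): the power of t then costs only half of the exponential
    decay. *)
Lemma gker_le a t : 0 < a -> 0 < t ->
  gker a t <= expR (a * ln (2 * a)) * expR (- (2^-1 * t)).
Proof.
move=> a0 t0; rewrite -expRD ler_expR.
have a2 : 0 < 2 * a by rewrite mulr_gt0.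
suff : a * (ln t - ln (2 * a)) <= 2^-1 * t by lra.
rewrite -ln_div ?posrE//.
have := ln_sublinear (divr_gt0 t0 a2) => /ltW h.
apply: (le_trans (ler_wpM2l (ltW a0) h)).
by rewrite le_eqVlt; apply/orP; left; apply/eqP; field; rewrite gt_eqF.
Qed.

Lemma cvg_expRNhalf : expR (- (2^-1 * t)) @[t --> +oo] --> (0 : R).
Proof.
apply: (cvg_comp (fun t : R => 2^-1 * t) (fun y => expR (- y))); last exact: cvgr_expR.
by apply: gt0_cvgMry; rewrite ?invr_gt0.
Qed.

Lemma cvg_gker_pinfty a : 0 < a -> gker a t @[t --> +oo] --> (0 : R).
Proof.
move=> a0; apply: (@squeeze_cvgr _ _ _ _ (fun=> 0)
    (fun t => expR (a * ln (2 * a)) * expR (- (2^-1 * t)))).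
- near=> t; have t0 : 0 < t by near: t; exact: nbhs_pinfty_gt.
  by rewrite expR_ge0 gker_le.
- exact: cvg_cst.
- rewrite -(mulr0 (expR (a * ln (2 * a)))).
  by apply: cvgM; [exact: cvg_cst|exact: cvg_expRNhalf].
Unshelve. all: by end_near. Qed.

Lemma cvg_gker_0 a : 0 < a -> gker a t @[t --> 0^'+] --> (0 : R).
Proof.
move=> a0; apply: (@squeeze_cvgr _ _ _ _ (fun=> 0) (fun t => t `^ a)).
- near=> t; have t0 : 0 < t by near: t; exact: nbhs_right_gt.
  by rewrite expR_ge0 /powR gt_eqF// ler_expR gerBl ltW.
- exact: cvg_cst.
- exact: powR_cvg0.
Unshelve. all: by end_near. Qed.

Lemma cvg_norm_le0 (F : set_system R) (f g : R -> R) : Filter F ->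
  (forall t, `|f t| <= g t) -> g t @[t --> F] --> (0 : R) ->
  f t @[t --> F] --> (0 : R).
Proof.
move=> FF fg g0; apply: norm_cvg0.
apply: (@squeeze_cvgr _ _ _ _ (fun=> 0) g) => //; last exact: cvg_cst.
by apply: nearW => t; rewrite normr_ge0 fg.
Qed.

Lemma continuous_gker a t : 0 < t -> {for t, continuous (gker a)}.
Proof. by move=> t0; exact: is_derive_continuous (is_derive_gker a t0). Qed.

Lemma continuous_gcos a m t : 0 < t -> {for t, continuous (gcos a m)}.
Proof. by move=> t0; exact: is_derive_continuous (is_derive_gcos a m t0). Qed.

Lemma continuous_gsin a m t : 0 < t -> {for t, continuous (gsin a m)}.
Proof. by move=> t0; exact: is_derive_continuous (is_derive_gsin a m t0). Qed.

Lemma integrable_expRNhalf :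
  mu.-integrable Rpos (EFin \o (fun t : R => expR (- (2^-1 * t)))).
Proof.
have dE x : is_derive x 1 (fun t : R => - 2 * expR (- (2^-1 * t))) (expR (- (2^-1 * x))).
  have h := is_derive_scale (- 2) (is_derive_compose
    (is_derive_opp (is_derive_scale 2^-1 (is_derive_id x 1))) (is_derive_expR (- (2^-1 * x)))).
  by apply: (is_derive_eq h); field.
have cE x : {for x, continuous (fun t : R => expR (- (2^-1 * t)))}.
  have h := is_derive_compose
    (is_derive_opp (is_derive_scale 2^-1 (is_derive_id x 1))) (is_derive_expR (- (2^-1 * x))).
  exact: is_derive_continuous h.
apply: (integrable_Rpos_ge0 (F := fun t => - 2 * expR (- (2^-1 * t)))
  (l0 := - 2 * expR (- (2^-1 * 0))) (l1 := - 2 * 0)).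
- by move=> x _; exact: expR_ge0.
- by move=> x _; exact: cE.
- by apply: cvg_at_right_filter; exact: is_derive_continuous (dE 0).
- by apply: cvgM; [exact: cvg_cst|exact: cvg_expRNhalf].
Qed.

Lemma integrable_gker a : 0 < a -> mu.-integrable Rpos (EFin \o gker a).
Proof.
move=> a0; apply: le_integrable (integrableZl _ (expR (a * ln (2 * a))) integrable_expRNhalf).
- exact: measurable_Rpos.
- by apply/measurable_EFinP; apply: measurable_fun_continuous_Rpos; exact: continuous_gker.
- move=> t; rewrite /Defs.Rpos /= in_itv /= andbT => t0.
  by rewrite lee_fin !ger0_norm ?mulr_ge0 ?expR_ge0// gker_le.
- exact: measurable_Rpos.
Qed.

Lemma integrable_gcos a m :
  mu.-integrable Rpos (EFin \o gker a) -> mu.-integrable Rpos (EFin \o gcos a m).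
Proof.
apply: le_integrable; first exact: measurable_Rpos.
- by apply/measurable_EFinP; apply: measurable_fun_continuous_Rpos => t; exact: continuous_gcos.
- by move=> t _; rewrite lee_fin (le_trans (gcos_le _ _ _))// ler_norm.
Qed.

Lemma integrable_gsin a m :
  mu.-integrable Rpos (EFin \o gker a) -> mu.-integrable Rpos (EFin \o gsin a m).
Proof.
apply: le_integrable; first exact: measurable_Rpos.
- by apply/measurable_EFinP; apply: measurable_fun_continuous_Rpos => t; exact: continuous_gsin.
- by move=> t _; rewrite lee_fin (le_trans (gsin_le _ _ _))// ler_norm.
Qed.

End GammaCriticalLine.

(** * The reflection formula on the critical line *)

Section GammaReflection.
Variable R : realType.
Implicit Types (x t a m : R).
Local Notation mu := (@lebesgue_measure R).
Local Notation Rpos := (@Rpos R).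
Import gauss_integral_proof.

(** The square root, written so that its derivative follows from those of exp and ln and that it is
    positive everywhere. *)
Let sqrtl t : R := expR (2^-1 * ln t).

Let sqrtl_gt0 t : 0 < sqrtl t. Proof. exact: expR_gt0. Qed.

Let sqrtl_sqr t : 0 < t -> sqrtl t ^+ 2 = t.
Proof.
by move=> t0; rewrite /sqrtl -expRM_natr (_ : _ * 2 = ln t) ?lnK ?posrE//; field.
Qed.

Lemma is_derive_integral0_gauss x : 0 < x ->
  is_derive x 1 (@integral0_gauss R) (gauss_fun x).
Proof.
move=> x0.
(* The interval of integration reaches past x, which makes x an interior point. *)
have xx1 : x < x + 1 by rewrite ltrDl.
have gi : mu.-integrable `[0, x + 1] (EFin \o (@gauss_fun R)).
  by apply: integrable_continuous_itv => y _; exact: continuous_gauss_fun.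
have [dG GE] := continuous_FTC1_closed xx1 gi x0 (@continuous_gauss_fun R x).
apply: DeriveDef; first exact: dG.
by rewrite -derive1E.
Qed.

Lemma integral0_gauss_le x : 0 < x -> integral0_gauss x <= x.
Proof.
move=> x0; have {2}-> : x = \int[mu]_(t in `[0, x]) (fun=> 1 : R) t.
  rewrite (Rintegral_FTC2_is_derive (F := id) x0) ?subr0//.
  by move=> y _; exact: cst_continuous.
apply: le_Rintegral => //.
- by apply: integrable_continuous_itv => y _; exact: continuous_gauss_fun.
- by apply: integrable_continuous_itv => y _; exact: cst_continuous.
- by move=> t _; exact: gauss_fun_le1.
Qed.

Lemma cvg_integral0_gauss :
  integral0_gauss x @[x --> +oo] --> (Num.sqrt pi / 2 : R).
Proof.
have : Num.sqrt (@integral0_gauss R x ^+ 2) @[x --> +oo] --> Num.sqrt (pi / 4).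
  by apply: continuous_cvg;
    [exact: sqrt_continuous|exact: cvg_integral0_gauss_sqr].
rewrite sqrtrM ?pi_ge0// sqrtrV// (_ : 4 = 2 ^+ 2); last first.
  by rewrite expr2 -natrM.
rewrite sqrtr_sqr ger0_norm//.
rewrite (_ : (fun _ => Num.sqrt _) = @integral0_gauss R)//.
apply/funext => r; rewrite sqrtr_sqr// ger0_norm//.
exact: integral0_gauss_ge0.
Qed.

(* The substitution t = x^2 turns the Gamma integral at 1/2 into the Gauss integral. *)
Let F t := 2 * @integral0_gauss R (sqrtl t).

Let dF t : 0 < t -> is_derive t 1 F (gker (- 2^-1) t).
Proof.
move=> t0; have h := is_derive_scale 2 (is_derive_compose
  (is_derive_compose (is_derive_lnM 2^-1 t0) (is_derive_expR (2^-1 * ln t)))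
  (is_derive_integral0_gauss (sqrtl_gt0 t))).
apply: (is_derive_eq h).
rewrite /gauss_fun sqrtl_sqr// -[X in _ / X]lnK ?posrE//.
rewrite (_ : _ * _ = expR (- t) * (expR (2^-1 * ln t) / expR (ln t))); last first.
  by field; rewrite gt_eqF ?expR_gt0.
by rewrite -expRB -expRD /gker; congr expR; field.
Qed.

Let F0 : F t @[t --> 0^'+] --> (2 * 0 : R).
Proof.
apply: cvgM; first exact: cvg_cst.
apply: (@squeeze_cvgr _ _ _ _ (fun=> 0) (fun t => t `^ (2^-1))).
- near=> t; have t0 : 0 < t by near: t; exact: nbhs_right_gt.
  rewrite integral0_gauss_ge0/= (le_trans (integral0_gauss_le _))//.
  by rewrite /powR gt_eqF.
- exact: cvg_cst.
- by apply: powR_cvg0; rewrite invr_gt0.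
Unshelve. all: by end_near. Qed.

Let F1 : F t @[t --> +oo] --> (2 * (Num.sqrt pi / 2) : R).
Proof.
apply: cvgM; first exact: cvg_cst.
apply: (cvg_comp sqrtl (@integral0_gauss R)); last exact: cvg_integral0_gauss.
apply/cvgryPge => A; near=> t.
have t0 : 0 < t by near: t; exact: nbhs_pinfty_gt.
have [A0|A0] := leP A 0; first by rewrite (le_trans A0)// ltW.
rewrite -(@ler_pXn2r _ 2) ?nnegrE ?(ltW A0) ?(ltW (sqrtl_gt0 t))// sqrtl_sqr//.
Unshelve. all: by end_near. Qed.

(** The exponent -1/2 is outside the range of [integrable_gker]; integrability comes from the
    explicit primitive [F] and its finite limits. *)
Lemma integrable_gkerNhalf : mu.-integrable Rpos (EFin \o gker (- 2^-1)).
Proof.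
apply: (integrable_Rpos_ge0 _ dF _ F0 F1); first by move=> x _; exact: expR_ge0.
by move=> x; exact: continuous_gker.
Qed.

Lemma gcos0 a : gcos a 0 = gker a.
Proof. by apply/funext => t; rewrite /gcos mul0r cos0 mulr1. Qed.

Lemma Gc_Nhalf0 : Gc (- 2^-1) 0 = Num.sqrt (pi : R).
Proof.
rewrite /Gc gcos0 (Rintegral_Rpos integrable_gkerNhalf dF _ F0 F1).
  by field.
by move=> x; exact: continuous_gker.
Qed.

(* Exponent of the Gamma integrand at argument n + 1/2. *)
Let half n : R := n%:R - 2^-1.

Lemma half0 : half 0 = - 2^-1. Proof. by rewrite /half sub0r. Qed.

Lemma halfS n : half n.+1 - 1 = half n.
Proof. by rewrite /half -natr1; ring. Qed.

Lemma half_gt0 n : 0 < half n.+1.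
Proof. by rewrite /half -natr1; have := ler0n R n; lra. Qed.

Lemma integrable_half n : mu.-integrable Rpos (EFin \o gker (half n)).
Proof.
case: n => [|n]; first by rewrite half0; exact: integrable_gkerNhalf.
exact/integrable_gker/half_gt0.
Qed.

(** Real part of Gamma(z + 1) = z Gamma(z) at z = a + i m: the derivative of [gcos a m] integrates
    to 0, since a > 0 kills the boundary value at 0. Integrability at a - 1 is assumed rather than
    derived from a > 1, so that a = 1/2 is covered. *)
Lemma Gc_rec a m : 0 < a -> mu.-integrable Rpos (EFin \o gker (a - 1)) ->
  Gc a m = a * Gc (a - 1) m - m * Gs (a - 1) m.
Proof.
move=> a0 i1; have i0 := integrable_gker a0.
have ic0 := integrable_gcos m i0; have ic1 := integrable_gcos m i1.
have is1 := integrable_gsin m i1.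
have mR := @measurable_Rpos R.
have ic1Z : mu.-integrable Rpos (EFin \o (fun t => a * gcos (a - 1) m t)).
  exact: integrable_EFinZl.
have is1Z : mu.-integrable Rpos (EFin \o (fun t => m * gsin (a - 1) m t)).
  exact: integrable_EFinZl.
have iB : mu.-integrable Rpos (EFin \o
    (fun t => a * gcos (a - 1) m t - m * gsin (a - 1) m t)).
  exact: integrable_EFinB.
have iBB : mu.-integrable Rpos (EFin \o
    (fun t => a * gcos (a - 1) m t - m * gsin (a - 1) m t - gcos a m t)).
  exact: integrable_EFinB.
have : \int[mu]_(t in Rpos)
    (a * gcos (a - 1) m t - m * gsin (a - 1) m t - gcos a m t) = 0 - 0.
  apply: (Rintegral_Rpos (F := gcos a m)) => //.
  - by move=> x; exact: is_derive_gcos.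
  - move=> x x0; apply: continuousB; last exact: continuous_gcos.
    by apply: continuousB; apply: continuousM;
      try exact: cst_continuous; (exact: continuous_gcos || exact: continuous_gsin).
  - by apply: (cvg_norm_le0 (g := gker a)); [exact: gcos_le|exact: cvg_gker_0].
  - by apply: (cvg_norm_le0 (g := gker a)); [exact: gcos_le|exact: cvg_gker_pinfty].
rewrite RintegralB// RintegralB// !RintegralZl// subrr => /eqP.
by rewrite subr_eq0 => /eqP h; symmetry; exact: h.
Qed.

Lemma Gs_rec a m : 0 < a -> mu.-integrable Rpos (EFin \o gker (a - 1)) ->
  Gs a m = a * Gs (a - 1) m + m * Gc (a - 1) m.
Proof.
move=> a0 i1; have i0 := integrable_gker a0.
have is0 := integrable_gsin m i0; have ic1 := integrable_gcos m i1.
have is1 := integrable_gsin m i1.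
have mR := @measurable_Rpos R.
have ic1Z : mu.-integrable Rpos (EFin \o (fun t => m * gcos (a - 1) m t)).
  exact: integrable_EFinZl.
have is1Z : mu.-integrable Rpos (EFin \o (fun t => a * gsin (a - 1) m t)).
  exact: integrable_EFinZl.
have iD : mu.-integrable Rpos (EFin \o
    (fun t => a * gsin (a - 1) m t + m * gcos (a - 1) m t)).
  exact: integrable_EFinD.
have iDB : mu.-integrable Rpos (EFin \o
    (fun t => a * gsin (a - 1) m t + m * gcos (a - 1) m t - gsin a m t)).
  exact: integrable_EFinB.
have : \int[mu]_(t in Rpos)
    (a * gsin (a - 1) m t + m * gcos (a - 1) m t - gsin a m t) = 0 - 0.
  apply: (Rintegral_Rpos (F := gsin a m)) => //.
  - by move=> x; exact: is_derive_gsin.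
  - move=> x x0; apply: continuousB; last exact: continuous_gsin.
    by apply: continuousD; apply: continuousM;
      try exact: cst_continuous; (exact: continuous_gcos || exact: continuous_gsin).
  - by apply: (cvg_norm_le0 (g := gker a)); [exact: gsin_le|exact: cvg_gker_0].
  - by apply: (cvg_norm_le0 (g := gker a)); [exact: gsin_le|exact: cvg_gker_pinfty].
rewrite RintegralB// RintegralD// !RintegralZl// subrr => /eqP.
by rewrite subr_eq0 => /eqP h; symmetry; exact: h.
Qed.

(** The squared modulus of Gamma (a + 1 + i m). *)
Definition Gnorm2 a m := Gc a m ^+ 2 + Gs a m ^+ 2.

Lemma Gnorm2_rec a m : 0 < a -> mu.-integrable Rpos (EFin \o gker (a - 1)) ->
  Gnorm2 a m = (a ^+ 2 + m ^+ 2) * Gnorm2 (a - 1) m.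
Proof. by move=> a0 i1; rewrite /Gnorm2 (Gc_rec m a0 i1) (Gs_rec m a0 i1); ring. Qed.

Lemma Gc0_rec a : 0 < a -> mu.-integrable Rpos (EFin \o gker (a - 1)) ->
  Gc a 0 = a * Gc (a - 1) 0.
Proof. by move=> a0 i1; rewrite Gc_rec// mul0r subr0. Qed.

Lemma Gc0_half_gt0 n : 0 < Gc (half n) 0.
Proof.
elim: n => [|n IH]; first by rewrite half0 Gc_Nhalf0 sqrtr_gt0 pi_gt0.
have := integrable_half n; rewrite -halfS => i1.
by rewrite Gc0_rec ?half_gt0// mulr_gt0 ?half_gt0// halfS.
Qed.

(** Each use of the functional equation multiplies the ratio of [Gnorm2] to the square of [Gc] at m
    = 0 by (h^2 + m^2) / h^2 = 1 + (2 m / (2 k + 1))^2, where h = k + 1/2. The factor pi is the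
    square of [Gc (- 2^-1) 0]. *)
Lemma Gnorm2_half n m :
  Gnorm2 (half n) m * pi =
  (\prod_(k < n) (1 + (2 * m / k.*2.+1%:R) ^+ 2)) * Gnorm2 (- 2^-1) m * Gc (half n) 0 ^+ 2.
Proof.
elim: n => [|n IH].
  by rewrite big_ord0 half0 Gc_Nhalf0 mul1r sqr_sqrtr ?pi_ge0.
have := integrable_half n; rewrite -halfS => i1.
rewrite Gc0_rec ?half_gt0// Gnorm2_rec ?half_gt0// halfS.
rewrite -[_ * Gnorm2 (half n) m * pi]mulrA IH big_ord_recr /=.
have -> : (n.*2.+1%:R : R) = 2 * half n.+1.
  by rewrite /half -muln2 -(natr1 (n * 2)) -(natr1 n) natrM; field.
by have := half_gt0 n; move: (half n.+1) => h h0; field; rewrite gt_eqF.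
Qed.

(** The modulus of an integral is at most the integral of the modulus. In real terms: pair the
    vector (c, s) of length r with the integrand, apply Cauchy-Schwarz pointwise to get r^2 <= r
    [Gc a 0], and divide by r. *)
Lemma Gnorm2_le a m : mu.-integrable Rpos (EFin \o gker a) ->
  Gnorm2 a m <= Gc a 0 ^+ 2.
Proof.
move=> i0; have mR := @measurable_Rpos R.
have ic0 := integrable_gcos m i0; have is0 := integrable_gsin m i0.
set c := Gc a m; set s := Gs a m; pose r := Num.sqrt (Gnorm2 a m).
have N0 : 0 <= Gnorm2 a m by rewrite addr_ge0// sqr_ge0.
have r2 : r ^+ 2 = Gnorm2 a m by rewrite sqr_sqrtr.
have r0 : 0 <= r by exact: sqrtr_ge0.
have icZ : mu.-integrable Rpos (EFin \o (fun t => c * gcos a m t)).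
  exact: integrable_EFinZl.
have isZ : mu.-integrable Rpos (EFin \o (fun t => s * gsin a m t)).
  exact: integrable_EFinZl.
have : c * Gc a m + s * Gs a m <= r * Gc a 0.
  rewrite /Gc /Gs gcos0 -!RintegralZl// -RintegralD//.
  apply: le_Rintegral => //.
  - exact: integrable_EFinD.
  - exact: integrable_EFinZl.
  - move=> t _; rewrite /gcos /gsin mulrCA (mulrCA s) -mulrDr mulrC.
    rewrite ler_wpM2r ?expR_ge0//.
    apply: (le_trans (ler_norm _)); rewrite -(@ler_pXn2r _ 2) ?nnegrE//.
    rewrite real_normK ?num_real// r2 /Gnorm2 -/c -/s.
    have := cos2Dsin2 (m * ln t); have := sqr_ge0 (c * sin (m * ln t) - s * cos (m * ln t)).
    move: (cos _) (sin _) => x y h xy.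
    have -> : c ^+ 2 + s ^+ 2 = (c ^+ 2 + s ^+ 2) * (x ^+ 2 + y ^+ 2) by rewrite xy mulr1.
    nra.
rewrite -/c -/s -!expr2 -[X in X <= _]/(Gnorm2 a m) -r2 expr2 => h.
have G0 : 0 <= Gc a 0.
  by rewrite /Gc gcos0; apply: Rintegral_ge0 => t _; exact: expR_ge0.
have [->|rn0] := eqVneq r 0; first by rewrite mul0r sqr_ge0.
have rp : 0 < r by rewrite lt_def rn0.
by rewrite ler_pM2l// in h; rewrite -expr2 lerXn2r ?nnegrE.
Qed.

(* Rotating by the phase m ln (a + 1) of the mean a + 1 leaves the expectation of
   cos (m x) with x = ln (t / (a + 1)); it is bounded below through
   1 - cos (m x) <= m^2 x^2 / 2 <= m^2 (e^x + e^-x - 2) / 2, whose expectation only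
   involves the Gamma integrals at exponents a - 1, a and a + 1. *)
Lemma Gnorm2_ge a m : 0 < a -> mu.-integrable Rpos (EFin \o gker (a - 1)) ->
  (1 - m ^+ 2 / a) * Gc a 0 ^+ 2 <= Gnorm2 a m.
Proof.
move=> a0 i1; have mR := @measurable_Rpos R.
have i0 := integrable_gker a0.
have ic0 := integrable_gcos m i0; have is0 := integrable_gsin m i0.
have a10 : 0 < a + 1 by lra.
have i2 := integrable_gker a10.
pose th := m * ln (a + 1); pose M := m ^+ 2 / 2.
set c := cos th; set s := sin th.
have icZ : mu.-integrable Rpos (EFin \o (fun t => c * gcos a m t)).
  exact: integrable_EFinZl.
have isZ : mu.-integrable Rpos (EFin \o (fun t => s * gsin a m t)).
  exact: integrable_EFinZl.
have iA : mu.-integrable Rpos (EFin \o (fun t => (1 + m ^+ 2) * gker a t)).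
  exact: integrable_EFinZl.
have iB : mu.-integrable Rpos (EFin \o (fun t => (M / (a + 1)) * gker (a + 1) t)).
  exact: integrable_EFinZl.
have iC : mu.-integrable Rpos (EFin \o (fun t => (M * (a + 1)) * gker (a - 1) t)).
  exact: integrable_EFinZl.
have iAB : mu.-integrable Rpos (EFin \o (fun t => (1 + m ^+ 2) * gker a t
   - (M / (a + 1)) * gker (a + 1) t)).
  exact: integrable_EFinB.
have h : (1 - m ^+ 2 / (2 * a)) * Gc a 0 <= c * Gc a m + s * Gs a m.
  have G1 : Gc (a + 1) 0 = (a + 1) * Gc a 0.
    by rewrite Gc0_rec// addrK.
  have G0 : Gc (a - 1) 0 = Gc a 0 / a.
    by rewrite (Gc0_rec a0 i1) mulrC mulKf ?gt_eqF.
  (* The right side integrates the density times 1 - m^2 (cosh x - 1). By the functional equation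
     its terms in m^2 add up to m^2 - M - M (a + 1) / a = - m^2 / (2 a). *)
  have -> : (1 - m ^+ 2 / (2 * a)) * Gc a 0 = (1 + m ^+ 2) * Gc a 0
      - (M / (a + 1)) * Gc (a + 1) 0 - (M * (a + 1)) * Gc (a - 1) 0.
    by rewrite G1 G0 /M; field; rewrite !gt_eqF.
  rewrite /Gc /Gs !gcos0 -!RintegralZl// -RintegralB// -RintegralB// -RintegralD//.
  apply: le_Rintegral => //.
  - exact: integrable_EFinB.
  - exact: integrable_EFinD.
  - move=> t; rewrite /Defs.Rpos /= in_itv /= andbT => t0.
    rewrite gker_sub1// (_ : gker (a + 1) t = gker a t * t); last first.
      by rewrite -{2}[a](addrK 1) gker_sub1// divfK// gt_eqF.
    pose x := ln (t / (a + 1)).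
    have -> : c * gcos a m t + s * gsin a m t = gker a t * cos (m * x).
      rewrite /x ln_div ?posrE// mulrBr cosB -/th -/c -/s /gcos /gsin; ring.
    have ex : expR x = t / (a + 1) by rewrite lnK// posrE divr_gt0.
    have eNx : expR (- x) = (a + 1) / t by rewrite expRN ex invf_div.
    have -> : (1 + m ^+ 2) * gker a t - M / (a + 1) * (gker a t * t)
        - M * (a + 1) * (gker a t / t) =
        gker a t * (1 - M * (2 * (coshR x - 1))).
      by rewrite /coshR ex eNx /M; field; rewrite !gt_eqF.
    rewrite ler_wpM2l ?expR_ge0//; apply: le_trans (cos_ge _).
    have := sqr_le_coshR x; rewrite /M exprMn; have := sqr_ge0 m.
    by move: (m ^+ 2) (x ^+ 2) (coshR x) => u v w u0 vw; nra.
have G0 : 0 <= Gc a 0.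
  by rewrite /Gc gcos0; apply: Rintegral_ge0 => t _; exact: expR_ge0.
(* Cauchy-Schwarz against the unit vector (c, s). *)
have cs : (c * Gc a m + s * Gs a m) ^+ 2 <= Gnorm2 a m.
  rewrite /Gnorm2; have := cos2Dsin2 th; rewrite -/c -/s.
  have := sqr_ge0 (c * Gs a m - s * Gc a m); move: (Gc a m) (Gs a m) => x y h1 xy.
  have -> : x ^+ 2 + y ^+ 2 = (x ^+ 2 + y ^+ 2) * (c ^+ 2 + s ^+ 2) by rewrite xy mulr1.
  nra.
apply: le_trans cs.
have e2 : m ^+ 2 / a = 2 * (m ^+ 2 / (2 * a)) by field; rewrite gt_eqF.
rewrite e2; move: h; set q := m ^+ 2 / (2 * a); move: (Gc a 0) G0 => g g0 h.
have q0 : 0 <= q by rewrite divr_ge0 ?sqr_ge0// mulr_ge0// ltW.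
(* Squaring [h] needs 1 - q >= 0, and then (1 - q)^2 >= 1 - 2 q. Otherwise 1 - 2 q is negative and
   the claim is trivial. *)
have [q1|q1] := leP 0 (1 - q).
  apply: (@le_trans _ _ (((1 - q) * g) ^+ 2)); first nra.
  by rewrite lerXn2r ?nnegrE ?mulr_ge0// (le_trans _ h)// mulr_ge0.
by apply: (@le_trans _ _ 0); rewrite ?sqr_ge0//; nra.
Qed.

(** Two limits of one sequence are compared. [coshR_prod] at b = 2 m makes [P n] tend to cosh (pi
    m), while [PE] turns the sequence into the ratio bounded by [Gnorm2_le] and [Gnorm2_ge], which
    tends to 1. *)
Lemma Gnorm2_Nhalf m : 0 <= m -> Gnorm2 (- 2^-1) m * coshR (pi * m) = pi.
Proof.
move=> m0.
pose P n := \prod_(k < n.+2) (1 + (2 * m / k.*2.+1%:R) ^+ 2).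
have PE n : P n * Gnorm2 (- 2^-1) m / pi = Gnorm2 (half n.+2) m / Gc (half n.+2) 0 ^+ 2.
  have g0 := Gc0_half_gt0 n.+2; have p0 := @pi_gt0 R.
  have -> : Gnorm2 (half n.+2) m = Gnorm2 (half n.+2) m * pi / pi.
    by rewrite mulfK// gt_eqF.
  rewrite Gnorm2_half -/(P n) -mulrA [_ / pi / _]mulrAC mulfK ?mulrA//.
  by rewrite expf_neq0// gt_eqF.
have c1 : P n * Gnorm2 (- 2^-1) m / pi @[n --> \oo] -->
    coshR (2 * m * (pi / 2)) * Gnorm2 (- 2^-1) m / pi.
  apply: cvgM; last exact: cvg_cst.
  apply: cvgM; last exact: cvg_cst.
  by apply: coshR_prod; rewrite mulr_ge0.
have c2 : P n * Gnorm2 (- 2^-1) m / pi @[n --> \oo] --> (1 : R).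
  (* The exponent is n + 3/2, so m^2 / (n + 1) exceeds the error term of [Gnorm2_ge]. *)
  apply: (@squeeze_cvgr _ _ _ _ (fun n => 1 - m ^+ 2 * (n.+1%:R)^-1) (fun=> 1));
    last exact: cvg_cst.
    apply: nearW => n; rewrite PE.
    have g0 := Gc0_half_gt0 n.+2; have g2 : 0 < Gc (half n.+2) 0 ^+ 2 by rewrite exprn_gt0.
    rewrite ler_pdivlMr// ler_pdivrMr// mul1r Gnorm2_le ?integrable_half// andbT.
    have := integrable_half n.+1; rewrite -halfS => i1.
    apply: le_trans (Gnorm2_ge m (half_gt0 _) i1).
    rewrite ler_wpM2r ?(ltW g2)// lerD2l lerN2 ler_wpM2l ?sqr_ge0//.
    rewrite lef_pV2 ?posrE ?half_gt0 ?ltr0n// /half -[n.+2%:R]natr1; lra.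
  have h : 1 - m ^+ 2 * (n.+1%:R)^-1 @[n --> \oo] --> 1 - m ^+ 2 * 0.
    apply: cvgB; first exact: cvg_cst.
    by apply: cvgM; [exact: cvg_cst|exact: cvg_harmonic].
  by rewrite mulr0 subr0 in h.
have e : coshR (2 * m * (pi / 2)) * Gnorm2 (- 2^-1) m / pi = 1.
  by apply: (cvg_unique _ c1 c2).
have p0 : pi != 0 :> R by rewrite gt_eqF ?pi_gt0.
rewrite -[RHS]mul1r -{2}e divfK//.
by rewrite mulrC (_ : 2 * m * (pi / 2) = pi * m)//; field.
Qed.

End GammaReflection.

Local Open Scope complex_scope.

(** * The entries of F *)

Section Symbol.
Variable R : realType.
Local Notation C := R[i].
Implicit Types (t m : R) (z w : C).
Local Notation mu := (@lebesgue_measure R).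
Local Notation Rpos := (@Rpos R).

Local Notation c_ := (Gc (- 2^-1 : R)).
Local Notation s_ := (Gs (- 2^-1 : R)).

Lemma Gamma_half m : Gamma (2^-1 +i* m) = c_ m +i* s_ m.
Proof.
rewrite /Gamma /cintegral_pos; congr (_ +i* _); apply: eq_Rintegral => t _;
  rewrite /cpow /cexp /=.
- rewrite !mul0r !mulr0 !subr0 !addr0 /gcos /gker.
  rewrite expRD mulrAC; congr (_ * _ * cos _); last by rewrite mulrC.
  by congr expR; field.
- rewrite !mul0r !mulr0 !subr0 !addr0 !add0r /gsin /gker.
  rewrite expRD mulrAC; congr (_ * _ * sin _); last by rewrite mulrC.
  by congr expR; field.
Qed.

Lemma GcN m : c_ (- m) = c_ m.
Proof. by apply: eq_Rintegral => t _; rewrite /gcos mulNr cosN. Qed.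

Lemma GsN m : s_ (- m) = - s_ m.
Proof.
rewrite /Gs -[RHS]mulN1r -RintegralZl; first last.
- exact/integrable_gsin/integrable_gkerNhalf.
- exact: measurable_Rpos.
by apply: eq_Rintegral => t _; rewrite /gsin mulNr sinN; ring.
Qed.

(** Dominated convergence with bound [gker (- 2^-1)], uniform in m. Continuity serves the
    measurability of the entries of F. *)
Lemma continuous_Gc : continuous c_.
Proof.
move=> m.
have mI : m \in (`](m - 1), (m + 1)[%classic : set R).
  by rewrite inE /= in_itv /=; apply/andP; split; lra.
apply: (@continuity_under_integral R _ _ mu (gcos (- 2^-1)) Rpos _ (m - 1) (m + 1)
  _ _ (gker (- 2^-1)) _ _ m mI).
- exact: measurable_Rpos.
- by move=> x _; exact/integrable_gcos/integrable_gkerNhalf.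
- by apply: aeW => t _ x _; exact: is_derive_continuous.
- exact: integrable_gkerNhalf.
- by move=> x _; apply: aeW => t _; exact: gcos_le.
Qed.

Lemma continuous_Gs : continuous s_.
Proof.
move=> m.
have mI : m \in (`](m - 1), (m + 1)[%classic : set R).
  by rewrite inE /= in_itv /=; apply/andP; split; lra.
apply: (@continuity_under_integral R _ _ mu (gsin (- 2^-1)) Rpos _ (m - 1) (m + 1)
  _ _ (gker (- 2^-1)) _ _ m mI).
- exact: measurable_Rpos.
- by move=> x _; exact/integrable_gsin/integrable_gkerNhalf.
- by apply: aeW => t _ x _; exact: is_derive_continuous.
- exact: integrable_gkerNhalf.
- by move=> x _; apply: aeW => t _; exact: gsin_le.
Qed.

(** * Squared moduli of complex numbers and of the entries *)

Lemma csqM z w : csq (z * w) = csq z * csq w.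
Proof. by case: z => a b; case: w => c d; rewrite /csq /=; ring. Qed.

Lemma csqR t : csq t%:C = t ^+ 2.
Proof. by rewrite /csq /= expr0n addr0. Qed.

Lemma csq_ge0 z : 0 <= csq z. Proof. by rewrite addr_ge0// sqr_ge0. Qed.

Lemma csqD_le z w : csq (z + w) <= 2 * (csq z + csq w).
Proof.
case: z => a b; case: w => c d; rewrite /csq /=.
by have := sqr_ge0 (a - c); have := sqr_ge0 (b - d); nra.
Qed.

Lemma csq_eq0 z : csq z = 0 -> z = 0.
Proof.
case: z => a b /eqP; rewrite /csq /= paddr_eq0 ?sqr_ge0// !sqrf_eq0.
by move=> /andP[/eqP -> /eqP ->].
Qed.

Lemma csqV z : csq z^-1 = (csq z)^-1.
Proof.
have [->|z0] := eqVneq z 0; first by rewrite invr0 /csq /= expr0n addr0 invr0.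
have cz : csq z != 0 by apply: contra_neq z0; exact: csq_eq0.
apply: (mulfI cz); rewrite -csqM !divff//.
by rewrite /csq /= expr1n expr0n addr0.
Qed.

Lemma csq_eipi4 : csq (eipi4 R) = 1.
Proof.
by rewrite /eipi4 /cexp csqM csqR /= expR0 expr1n mul1r /csq /= cos2Dsin2.
Qed.

Lemma eipi4_neq0 : eipi4 R != 0.
Proof.
apply/eqP => e; have := csq_eipi4; rewrite e /csq /= expr0n addr0 => /eqP.
by rewrite eq_sym oner_eq0.
Qed.

Lemma FpmE m : Fpm m = ((Num.sqrt (2 * pi))^-1)%:C * eipi4 R
  * (expR (- (pi * m / 2)))%:C * (c_ m +i* s_ m).
Proof. by rewrite /Fpm Gamma_half. Qed.

Lemma FmpE m : Fmp m = ((Num.sqrt (2 * pi))^-1)%:C * eipi4 R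
  * (expR (pi * m / 2))%:C * (c_ m +i* (- s_ m)).
Proof. by rewrite /Fmp Gamma_half GcN GsN. Qed.

(* (2 cosh (pi m))^-1 is |F_{+-} F_{-+}|, up to sign the determinant of F(m). *)
Definition symdet m : R := (2 * coshR (pi * m))^-1.

Lemma coshR_gt0 m : 0 < coshR m.
Proof. by rewrite (lt_le_trans ltr01)// coshR_ge1. Qed.

Lemma symdet_gt0 m : 0 < symdet m.
Proof. by rewrite invr_gt0 mulr_gt0// coshR_gt0. Qed.

Lemma symdet_le m : symdet m <= 2^-1.
Proof.
have h := coshR_ge1 (pi * m).
by rewrite lef_pV2 ?posrE//; lra.
Qed.

Lemma symdetE m : 0 <= m -> ((Num.sqrt (2 * pi))^-1) ^+ 2 * Gnorm2 (- 2^-1) m = symdet m.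
Proof.
move=> m0; rewrite exprVn sqr_sqrtr ?mulr_ge0 ?pi_ge0//.
have p0 : pi != 0 :> R by rewrite gt_eqF ?pi_gt0.
have ch : coshR (pi * m) != 0 by rewrite gt_eqF ?coshR_gt0.
rewrite (_ : Gnorm2 _ _ = pi / coshR (pi * m)); last first.
  by apply: (mulIf ch); rewrite Gnorm2_Nhalf// divfK.
by rewrite /symdet !invfM -mulrA mulKf.
Qed.

(** The weights exp (- pi m / 2) and exp (pi m / 2) cancel and the two Gamma values are conjugate,
    which leaves a real multiple of the squared phase. *)
Lemma FpmFmp m : 0 <= m -> Fpm m * Fmp m = eipi4 R ^+ 2 * (symdet m)%:C.
Proof.
move=> m0; rewrite FpmE FmpE -(symdetE m0).
have -> : Gnorm2 (- 2^-1) m =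
   expR (- (pi * m / 2)) * expR (pi * m / 2) * Gnorm2 (- 2^-1) m.
  by rewrite -expRD addNr expR0 mul1r.
have e : (c_ m +i* s_ m) * (c_ m +i* (- s_ m)) = (Gnorm2 (- 2^-1) m)%:C.
  by apply/eqP; rewrite eq_complex /= /Gnorm2; apply/andP; split; apply/eqP; ring.
rewrite !rmorphM /= -e.
move: (_ +i* _) (_ +i* _) (eipi4 R) => u v w; ring.
Qed.

Lemma csq_Fpm m : 0 <= m -> csq (Fpm m) = expR (- (pi * m / 2)) ^+ 2 * symdet m.
Proof.
move=> m0; rewrite FpmE 3!csqM 2!csqR csq_eipi4 -symdetE//.
by rewrite /csq /= /Gnorm2; ring.
Qed.

Lemma csq_Fmp m : 0 <= m -> csq (Fmp m) = expR (pi * m / 2) ^+ 2 * symdet m.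
Proof.
move=> m0; rewrite FmpE 3!csqM 2!csqR csq_eipi4 -symdetE//.
by rewrite /csq /= sqrrN /Gnorm2; ring.
Qed.

(** The squared modulus is e^(- pi m) / (e^(pi m) + e^(- pi m)); that of the other entry has e^(pi
    m) on top. *)
Lemma csq_Fpm_le1 m : 0 <= m -> csq (Fpm m) <= 1.
Proof.
move=> m0; have c0 : 0 < 2 * coshR (pi * m) by rewrite mulr_gt0// coshR_gt0.
rewrite csq_Fpm// -expRM_natr /symdet ler_pdivrMr// mul1r.
rewrite (_ : - (pi * m / 2) * 2 = - (pi * m)); last by field.
by rewrite /coshR; have := expR_gt0 (pi * m); lra.
Qed.

Lemma csq_Fmp_le1 m : 0 <= m -> csq (Fmp m) <= 1.
Proof.
move=> m0; have c0 : 0 < 2 * coshR (pi * m) by rewrite mulr_gt0// coshR_gt0.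
rewrite csq_Fmp// -expRM_natr /symdet ler_pdivrMr// mul1r.
rewrite (_ : pi * m / 2 * 2 = pi * m); last by field.
by rewrite /coshR; have := expR_gt0 (- (pi * m)); lra.
Qed.

Lemma continuous_coshpi m : {for m, continuous (fun m => coshR (pi * m))}.
Proof. exact: is_derive_continuous (is_derive_coshRM pi m). Qed.

Lemma continuous_symdet m : {for m, continuous symdet}.
Proof.
apply: continuousV; first by rewrite gt_eqF// mulr_gt0// coshR_gt0.
by apply: continuousM; [exact: cst_continuous|exact: continuous_coshpi].
Qed.

(** * Measurability of complex functions *)

Lemma cmeasurableM (f g : R -> C) : cmeasurable f -> cmeasurable g ->
  cmeasurable (fun t => f t * g t).
Proof.
move=> [f1 f2] [g1 g2].
have ReM z w : complex.Re (z * w) = complex.Re z * complex.Re w - complex.Im z * complex.Im w.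
  by case: z; case: w.
have ImM z w : complex.Im (z * w) = complex.Re z * complex.Im w + complex.Im z * complex.Re w.
  by case: z; case: w.
split.
- under eq_fun do rewrite ReM.
  by apply: measurable_funB; apply: measurable_funM.
- under eq_fun do rewrite ImM.
  by apply: measurable_funD; apply: measurable_funM.
Qed.

Lemma cmeasurableD (f g : R -> C) : cmeasurable f -> cmeasurable g ->
  cmeasurable (fun t => f t + g t).
Proof.
move=> [f1 f2] [g1 g2].
have ReD z w : complex.Re (z + w) = complex.Re z + complex.Re w by case: z; case: w.
have ImD z w : complex.Im (z + w) = complex.Im z + complex.Im w by case: z; case: w.
split.
- by under eq_fun do rewrite ReD; apply: measurable_funD.
- by under eq_fun do rewrite ImD; apply: measurable_funD.
Qed.

Lemma cmeasurable_cst z : cmeasurable (fun=> z).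
Proof. by split; exact: measurable_cst. Qed.

Lemma cmeasurable_complex (f g : R -> R) :
  measurable_fun Rpos f -> measurable_fun Rpos g -> cmeasurable (fun t => f t +i* g t).
Proof. by move=> mf mg; split. Qed.

Lemma cmeasurable_real (f : R -> R) : measurable_fun Rpos f -> cmeasurable (fun t => (f t)%:C).
Proof. by move=> mf; split => //=; exact: measurable_cst. Qed.

Lemma measurable_continuous (f : R -> R) : continuous f -> measurable_fun Rpos f.
Proof. by move=> cf; apply: measurable_fun_continuous_Rpos => x _; exact: cf. Qed.

Let measurable_expRM (k : R) : measurable_fun Rpos (fun m : R => expR (k * m)).
Proof.
apply: measurable_continuous => m; apply: is_derive_continuous.
Qed.

Lemma cmeasurable_Fpm : cmeasurable (@Fpm R).
Proof.
have -> := funext (@FpmE).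
apply: cmeasurableM; last first.
  by apply: cmeasurable_complex; apply: measurable_continuous;
    [exact: continuous_Gc|exact: continuous_Gs].
apply: cmeasurableM; first exact: cmeasurable_cst.
apply: cmeasurable_real.
rewrite (_ : (fun _ => _) = (fun m : R => expR (- (pi / 2) * m))) //.
by apply/funext => m; congr expR; field.
Qed.

Lemma cmeasurable_Fmp : cmeasurable (@Fmp R).
Proof.
have -> := funext (@FmpE).
apply: cmeasurableM; last first.
  apply: cmeasurable_complex; first by apply: measurable_continuous; exact: continuous_Gc.
  by apply: measurable_funN; apply: measurable_continuous; exact: continuous_Gs.
apply: cmeasurableM; first exact: cmeasurable_cst.
apply: cmeasurable_real.
rewrite (_ : (fun _ => _) = (fun m : R => expR ((pi / 2) * m))) //.
by apply/funext => m; congr expR; field.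
Qed.

End Symbol.

(** * The spectrum *)

Section Spectrum.
Variable R : realType.
Local Notation C := R[i].
Implicit Types (t m : R) (lam : C) (y z : vec R).
Local Notation mu := (@lebesgue_measure R).
Local Notation Rpos := (@Rpos R).

(** Density of [normM2]: norm bounds for multiplication operators follow from pointwise bounds on
    it. *)
Definition nrm2 y t : R := csq (y t).1 + csq (y t).2.

Lemma nrm2_ge0 y t : 0 <= nrm2 y t.
Proof. by rewrite addr_ge0// csq_ge0. Qed.

Lemma measurable_csq (f : R -> C) : cmeasurable f -> measurable_fun Rpos (fun t => csq (f t)).
Proof. by move=> [f1 f2]; apply: measurable_funD; apply: measurable_funX. Qed.

Lemma L2pos_integrable (f : R -> C) : L2pos f ->
  mu.-integrable Rpos (EFin \o (fun t => csq (f t))).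
Proof.
move=> [mf fi]; apply/integrableP; split.
  by apply/measurable_EFinP; exact: measurable_csq.
under eq_integral do rewrite /= ger0_norm ?csq_ge0//.
exact: fi.
Qed.

Lemma inM_integrable y : inM y -> mu.-integrable Rpos (EFin \o nrm2 y).
Proof.
move=> [y1 y2]; apply: integrable_EFinD; [exact: measurable_Rpos|..];
  exact: L2pos_integrable.
Qed.

Lemma inM_dominated z (g : R -> R) : mu.-integrable Rpos (EFin \o g) ->
  cmeasurable (fun t => (z t).1) -> cmeasurable (fun t => (z t).2) ->
  (forall t, 0 < t -> nrm2 z t <= g t) -> inM z.
Proof.
move=> ig mz1 mz2 zg.
have aux (f : R -> C) : cmeasurable f -> (forall t, 0 < t -> csq (f t) <= g t) ->
    L2pos f.
  move=> mf fg; split => //.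
  have /integrableP[_] : mu.-integrable Rpos (EFin \o (fun t => csq (f t))).
    apply: le_integrable ig; first exact: measurable_Rpos.
      by apply/measurable_EFinP; exact: measurable_csq.
    move=> t; rewrite /Defs.Rpos /= in_itv /= andbT => t0.
    by rewrite lee_fin ger0_norm ?csq_ge0// (le_trans (fg _ t0))// ler_norm.
  by under eq_integral do rewrite /= ger0_norm ?csq_ge0//.
by split; apply: aux => // t t0; apply: le_trans (zg _ t0);
  rewrite /nrm2 ?lerDl ?lerDr csq_ge0.
Qed.

Lemma inM_le y z (K : R) : inM y ->
  cmeasurable (fun t => (z t).1) -> cmeasurable (fun t => (z t).2) ->
  (forall t, 0 < t -> nrm2 z t <= K * nrm2 y t) -> inM z.
Proof.
move=> yM; apply: inM_dominated; apply: integrable_EFinZl (inM_integrable yM).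
exact: measurable_Rpos.
Qed.

Lemma normM2_le y z (K : R) : inM y -> inM z ->
  (forall t, 0 < t -> nrm2 z t <= K * nrm2 y t) -> normM2 z <= K * normM2 y.
Proof.
move=> yM zM zy; have mR := @measurable_Rpos R.
rewrite /normM2 -RintegralZl//; last exact: inM_integrable.
apply: le_Rintegral => //; first exact: inM_integrable.
  exact/integrable_EFinZl/inM_integrable.
by move=> t; rewrite /Defs.Rpos /= in_itv /= andbT => t0; exact: zy.
Qed.

Lemma eqM_ae (P : R -> Prop) y z : eqM y z ->
  (forall t, y t = z t -> P t) -> {ae mu, forall t, Rpos t -> P t}.
Proof.
move=> yz yzP; have FF := ae_filter_ringOfSetsType mu.
by apply: filterS yz => t h Rt; apply: yzP; exact: h.
Qed.

Lemma normM2_eqM y z : inM y -> inM z -> eqM y z -> normM2 y = normM2 z.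
Proof.
move=> yM zM yz; congr fine; apply: ae_eq_integral.
- exact: measurable_Rpos.
- exact: measurable_int (inM_integrable yM).
- exact: measurable_int (inM_integrable zM).
- by apply: (eqM_ae yz) => t ->.
Qed.

Lemma inM_measurable y : inM y ->
  cmeasurable (fun t => (y t).1) /\ cmeasurable (fun t => (y t).2).
Proof. by move=> [[]] + _ [] +. Qed.

Lemma eqM_pointwise y z : (forall t, 0 < t -> y t = z t) -> eqM y z.
Proof.
by move=> yz; apply: aeW => t; rewrite /Defs.Rpos /= in_itv /= andbT => t0; exact: yz.
Qed.

(* (F + lam) / (F^2 - lam^2). *)
Definition resolvent lam y : vec R := fun t =>
  let w := (eipi4 R ^+ 2 * (symdet t)%:C - lam ^+ 2)^-1 in
  (w * (Fpm t * (y t).2 + lam * (y t).1), w * (Fmp t * (y t).1 + lam * (y t).2)).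

Lemma cmeasurableV (f : R -> C) : cmeasurable f -> cmeasurable (fun t => (f t)^-1).
Proof.
move=> mf; have [mf1 mf2] := mf.
(* The inverse is conj z / |z|^2. The real inverse is taken as a power with exponent -1, a
   measurable function that agrees with it on nonnegative numbers, 0 included. *)
have mV : measurable_fun Rpos (fun t => (csq (f t)) `^ (-1)).
  apply: (@measurableT_comp _ _ _ _ _ _ (fun x : R => x `^ (-1))).
    exact: measurable_powR.
  exact: measurable_csq.
have VE t : (f t)^-1 = ((csq (f t)) `^ (-1))%:C * (complex.Re (f t) -i* complex.Im (f t)).
  rewrite powR_inv1 ?csq_ge0//; case: (f t) => a b /=.
  by apply/eqP; rewrite eq_complex /= /csq /=; apply/andP; split; apply/eqP; ring.
rewrite (funext VE); apply: cmeasurableM; first exact: cmeasurable_real.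
by apply: cmeasurable_complex => //; exact: measurable_funN.
Qed.

Lemma cmeasurable_resolvent_factor lam :
  cmeasurable (fun t => (eipi4 R ^+ 2 * (symdet t)%:C - lam ^+ 2)^-1).
Proof.
apply: cmeasurableV; apply: cmeasurableD; last exact: cmeasurable_cst.
apply: cmeasurableM; first exact: cmeasurable_cst.
by apply: cmeasurable_real; apply: measurable_continuous => t; exact: continuous_symdet.
Qed.

Lemma resolvent_invertible lam (d : R) : 0 < d ->
  (forall t, d <= csq (eipi4 R ^+ 2 * (symdet t)%:C - lam ^+ 2)) ->
  invertibleM (shiftM (@MF R) lam).
Proof.
move=> d0 hd; exists (resolvent lam).
have mw := cmeasurable_resolvent_factor lam.
(* The scalar factor contributes at most 1 / d, and F + lam at most 2 (1 + |lam|^2), the entries of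
   F being bounded by 1. *)
pose K := d^-1 * (2 * (1 + csq lam)).
have bnd y t : 0 < t -> nrm2 (resolvent lam y) t <= K * nrm2 y t.
  move=> t0; rewrite /nrm2 /resolvent; set w := (_ - _)^-1 => /=.
  have wd : csq w <= d^-1 by rewrite csqV lef_pV2 ?posrE// (lt_le_trans d0).
  rewrite 2!(csqM w) -mulrDr /K -mulrA.
  have a1 := csqD_le (Fpm t * (y t).2) (lam * (y t).1).
  have a2 := csqD_le (Fmp t * (y t).1) (lam * (y t).2).
  rewrite (csqM (Fpm t)) (csqM lam) in a1.
  rewrite (csqM (Fmp t)) (csqM lam) in a2.
  have p1 := csq_Fpm_le1 (ltW t0); have p2 := csq_Fmp_le1 (ltW t0).
  move: a1 a2 p1 p2 (csq_ge0 w) (csq_ge0 (y t).1) (csq_ge0 (y t).2) (csq_ge0 lam).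
  move: (csq_ge0 (Fpm t * (y t).2 + lam * (y t).1)).
  move: (csq_ge0 (Fmp t * (y t).1 + lam * (y t).2)).
  move: (csq (y t).1) (csq (y t).2) (csq lam) (csq w) wd (csq (Fpm t)) (csq (Fmp t)).
  move: (csq (_ + _)) (csq (_ + _)) => A B a b l v vd p q A0 B0 a1 a2 p1 p2 v0 a0 b0 l0.
  apply: ler_pM => //; first by rewrite addr_ge0.
  nra.
have resM y : inM y -> inM (resolvent lam y).
  move=> yM; have [m1 m2] := inM_measurable yM.
  apply: (inM_le yM) (bnd y).
  - apply: cmeasurableM => //; apply: cmeasurableD; apply: cmeasurableM => //.
    exact: cmeasurable_Fpm.
  - apply: cmeasurableM => //; apply: cmeasurableD; apply: cmeasurableM => //.
    exact: cmeasurable_Fmp.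
split; first split.
- exact: resM.
- by move=> y z yM zM yz; apply: (eqM_ae yz) => t; rewrite /resolvent => ->.
- move=> a b y z yM zM; apply: eqM_pointwise => t t0; rewrite /resolvent /=.
  by congr (_, _); ring.
- by exists K => y yM; apply: normM2_le => //; [exact: resM|exact: bnd].
- move=> y yM; have w0 t : 0 < t -> Fpm t * Fmp t - lam ^+ 2 != 0.
    move=> t0; rewrite FpmFmp ?ltW//; apply/eqP => e; have := hd t.
    by rewrite e /csq /= expr0n addr0 leNgt d0.
  split; apply: eqM_pointwise => t t0; rewrite /resolvent /shiftM /MF /=;
    rewrite -FpmFmp ?ltW//; have := w0 _ t0; case: (y t) => a b /=;
    move: (Fpm t) (Fmp t) => p q pq; congr (_, _); by field.
Qed.

(** The square of z = a + i b stays away from [0, 1/2]: for b = 0 it is a^2 > 1/2, for a = 0 it is -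
    b^2 < 0, and otherwise its imaginary part 2 a b is nonzero. *)
Lemma csq_square_gap (z : C) : (forall x : R, x ^+ 2 <= 2^-1 -> z != x%:C) ->
  exists2 d : R, 0 < d & forall u : R, 0 <= u <= 2^-1 -> d <= csq (u%:C - z ^+ 2).
Proof.
case: z => a b hz.
have E u : csq (u%:C - (a +i* b) ^+ 2) = (u - a ^+ 2 + b ^+ 2) ^+ 2 + 4 * (a ^+ 2 * b ^+ 2).
  by rewrite expr2 /csq /=; ring.
have [b0|b0] := eqVneq b 0.
  have a2 : 2^-1 < a ^+ 2.
    rewrite ltNge; apply/negP => /hz; rewrite b0; by rewrite eqxx.
  exists ((a ^+ 2 - 2^-1) ^+ 2); first by rewrite exprn_gt0// subr_gt0.
  by move=> u /andP[u0 u1]; rewrite E b0 expr0n /=; nra.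
have b2 : 0 < b ^+ 2 by rewrite lt_def sqrf_eq0 b0 sqr_ge0.
have [a0|a0] := eqVneq a 0.
  exists (b ^+ 2 ^+ 2); first by rewrite exprn_gt0.
  by move=> u /andP[u0 u1]; rewrite E a0 expr0n /=; nra.
have a2 : 0 < a ^+ 2 by rewrite lt_def sqrf_eq0 a0 sqr_ge0.
exists (4 * (a ^+ 2 * b ^+ 2)); first by apply: mulr_gt0 => //; exact: mulr_gt0.
by move=> u _; rewrite E lerDr sqr_ge0.
Qed.

(** Division by e^{i pi/4}, of modulus 1, rotates the segment onto a real interval and makes F^2 the
    real scalar [symdet], with values in (0, 1/2]. *)
Lemma notin_spectrum lam : (forall x : R, x ^+ 2 <= 2^-1 -> lam != eipi4 R * x%:C) ->
  invertibleM (shiftM (@MF R) lam).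
Proof.
move=> hlam; have e0 := @eipi4_neq0 R.
have [|d d0 hd] := @csq_square_gap (lam / eipi4 R).
  move=> x /hlam; apply: contra_neq => /(congr1 (fun z : C => z * eipi4 R)).
  by rewrite divfK// mulrC.
apply: (resolvent_invertible d0) => t.
have -> : eipi4 R ^+ 2 * (symdet t)%:C - lam ^+ 2 =
   eipi4 R * eipi4 R * ((symdet t)%:C - (lam / eipi4 R) ^+ 2).
  by field.
rewrite csqM (csqM (eipi4 R)) csq_eipi4 !mul1r; apply: hd.
by rewrite symdet_le ltW// symdet_gt0.
Qed.

Lemma symdet0 : symdet 0 = 2^-1 :> R.
Proof. by rewrite /symdet mulr0 coshR0 mulr1. Qed.

Lemma continuous_sqrt_symdet t :
  {for t, continuous (fun t => Num.sqrt (symdet t) : R)}.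
Proof.
apply: continuous_comp; first exact: continuous_symdet.
exact: sqrt_continuous.
Qed.

(** The function falls from 1 / sqrt 2 at 0 towards 0 at infinity, so the intermediate value theorem
    reaches x, unless x is so small that a far point is already close enough. The interval lies to
    the right of m because m may be 0. *)
Lemma sqrt_symdet_near (x e : R) : 0 <= x -> x ^+ 2 <= 2^-1 -> 0 < e ->
  exists2 m, 0 <= m & exists2 r : R, 0 < r &
    forall t, m < t < m + r -> (Num.sqrt (symdet t) - x) ^+ 2 <= e ^+ 2.
Proof.
move=> x0 x2 e0; pose g t : R := Num.sqrt (symdet t).
have cg t : {for t, continuous g} by exact: continuous_sqrt_symdet.
have [m m0 gm] : exists2 m, 0 <= m & `|g m - x| < e.
  (* Since 2 cosh (pi M) >= M^2, the value at M is at most 1 / M = e / 2. *)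
  pose M : R := 2 / e.
  have M0 : 0 < M by rewrite divr_gt0.
  have gM : g M <= e / 2.
    rewrite -(@ler_pXn2r _ 2) ?nnegrE ?sqrtr_ge0 ?divr_ge0 ?(ltW e0)//.
    rewrite sqr_sqrtr ?(ltW (symdet_gt0 _))//.
    have -> : (e / 2) ^+ 2 = (M ^+ 2)^-1 by rewrite -exprVn /M invf_div.
    have c0 : 0 < 2 * coshR (pi * M) by rewrite mulr_gt0// coshR_gt0.
    rewrite lef_pV2 ?posrE ?exprn_gt0//.
    have := sqr_le_coshR (pi * M); rewrite exprMn => h.
    have p2 : 1 <= pi ^+ 2 :> R by rewrite expr_ge1 ?pi_ge0// (le_trans _ (@pi_ge2 R))// ler1n.
    have M2 := sqr_ge0 M.
    nra.
  have [xM|xM] := leP x (g M).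
    exists M; first exact: ltW.
    rewrite ger0_norm ?subr_ge0//; lra.
  have g0 : x <= g 0.
    rewrite -(@ler_pXn2r _ 2) ?nnegrE ?sqrtr_ge0//.
    by rewrite sqr_sqrtr ?(ltW (symdet_gt0 _))// symdet0.
  have [| |m] := @IVT R g 0 M x (ltW M0).
  - apply/subspace_continuousP => t _.
    by apply: cvg_within_filter; exact: cg.
  - by rewrite ge_min le_max (ltW xM) g0 orbT.
  - rewrite in_itv /= => /andP[m0 _] gm; exists m => //.
    by rewrite gm subrr normr0.
exists m => //.
have e1 : 0 < e - `|g m - x| by rewrite subr_gt0.
have /cvgrPdist_lt/(_ _ e1)/nbhs_ballP[r /= r0 hr] : g t @[t --> m] --> g m by exact: cg.
exists r => // t /andP[mt tm].
rewrite -[X in X <= _]real_normK ?num_real// lerXn2r ?nnegrE ?(ltW e0)//.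
have : `|g m - g t| < e - `|g m - x|.
  by apply: hr; rewrite /ball /= ltr0_norm; lra.
rewrite -[Num.sqrt _]/(g t) distrC ltrBrDr => h.
by apply: (le_trans (ler_distD (g m) (g t) x)); exact: ltW.
Qed.

(* The eigenvector (F_{+-}, ev) of F with eigenvalue ev, cut off to an interval on
   which ev is within e of e^{i pi/4} x. *)
Lemma in_spectrum (x : R) : x ^+ 2 <= 2^-1 ->
  ~ invertibleM (shiftM (@MF R) (eipi4 R * x%:C)).
Proof.
move=> x2 [S [[SM Seq _ [c Sc]] TS]].
(* The constant c of the inverse may be 0 or negative, so a positive K replaces it. The choice of e
   makes K e^2 < 1, which will contradict |y|^2 <= K e^2 |y|^2 for a nonzero y. *)
pose K : R := `|c| + 1.
have K0 : 0 < K by rewrite ltr_pwDr.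
pose e := (2 * K)^-1.
have e0 : 0 < e by rewrite invr_gt0 mulr_gt0.
have Ke : K * e ^+ 2 < 1.
  have Ke2 : K * e = 2^-1 by rewrite /e invfM mulrCA divff ?mulr1// gt_eqF.
  have e1 : e <= 2^-1.
    rewrite lef_pV2 ?posrE ?mulr_gt0// ler_peMr// /K.
    by rewrite lerDr.
  rewrite expr2 mulrA Ke2; lra.
have [|||m m0 [r r0 hr]] := @sqrt_symdet_near `|x| e.
- exact: normr_ge0.
- by rewrite real_normK ?num_real.
- exact: e0.
(* Selects the branch of the eigenvalue on the side of x; it is 1, not 0, at x = 0. *)
pose sg : R := if 0 <= x then 1 else -1.
have sg2 : sg ^+ 2 = 1 by rewrite /sg; case: ifP => _; rewrite ?sqrrN expr1n.
have xsg : x = sg * `|x|.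
  rewrite /sg; case: ifPn => [h|]; first by rewrite ger0_norm ?mul1r.
  by rewrite -ltNge => h; rewrite ltr0_norm// mulN1r opprK.
pose ev t : C := eipi4 R * (sg * Num.sqrt (symdet t))%:C.
have ev2 t : 0 < t -> ev t * ev t = Fpm t * Fmp t.
  move=> t0; rewrite FpmFmp ?ltW// /ev.
  have -> : (symdet t)%:C = ((sg * Num.sqrt (symdet t)) ^+ 2)%:C.
    by rewrite exprMn sg2 mul1r sqr_sqrtr// ltW// symdet_gt0.
  rewrite rmorphXn /=; ring.
have csq_ev t : csq (ev t) = symdet t.
  by rewrite csqM csq_eipi4 csqR mul1r exprMn sg2 mul1r sqr_sqrtr// ltW// symdet_gt0.
pose I : set R := `]m, (m + r)[%classic.
pose ind t : C := (\1_I t)%:C.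
pose y : vec R := fun t => (ind t * Fpm t, ind t * ev t).
pose lam := eipi4 R * x%:C.
pose k t : C := ev t - lam.
have TyE t : 0 < t -> shiftM (@MF R) lam y t = (k t * (y t).1, k t * (y t).2).
  move=> t0; rewrite /shiftM /MF /y /k /=; congr (_, _); first by ring.
  by rewrite mulrCA [Fmp t * _]mulrC -ev2//; ring.
have mI : measurable I by exact: measurable_itv.
have muI : lebesgue_measure I = r%:E.
  by rewrite /I lebesgue_measure_itv /= lte_fin ltrDl r0 -EFinB addrAC subrr add0r.
have mR := @measurable_Rpos R.
have IR : I `<=` Rpos.
  move=> t; rewrite /I /Defs.Rpos /= !in_itv /= andbT => /andP[mt _].
  exact: le_lt_trans mt.
have mind : cmeasurable ind.
  by apply: cmeasurable_real; exact: measurable_indic.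
have msd : measurable_fun Rpos (fun t => sg * Num.sqrt (symdet t) : R).
  apply: measurable_fun_continuous_Rpos => t _; apply: continuousM.
    exact: cst_continuous.
  exact: continuous_sqrt_symdet.
have mev : cmeasurable ev.
  by apply: cmeasurableM; [exact: cmeasurable_cst|exact: cmeasurable_real].
have mk : cmeasurable k by apply: cmeasurableD => //; apply: cmeasurable_cst.
have my1 : cmeasurable (fun t => (y t).1).
  by apply: cmeasurableM => //; exact: cmeasurable_Fpm.
have my2 : cmeasurable (fun t => (y t).2) by apply: cmeasurableM.
have ind2 t : csq (ind t) = \1_I t.
  by rewrite csqR indicE; case: (_ \in _); rewrite ?expr1n ?expr0n.
have nE t : nrm2 y t = \1_I t * (csq (Fpm t) + symdet t).
  rewrite /nrm2 -[(y t).1]/(ind t * Fpm t) -[(y t).2]/(ind t * ev t).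
  by rewrite (csqM (ind t)) (csqM (ind t)) ind2 csq_ev [RHS]mulrDr.
have indI : mu.-integrable Rpos (EFin \o (fun t => 2 * \1_I t)).
  apply: integrable_EFinZl => //.
  by apply: (integrableS measurableT) => //; exact: integrable_indic_itv.
have yM : inM y.
  apply: (inM_dominated indI) => // t t0; rewrite nE mulrC ler_wpM2r//.
  by have := csq_Fpm_le1 (ltW t0); have := symdet_le t; lra.
have kb t : I t -> csq (k t) <= e ^+ 2.
  rewrite /I /= in_itv /= => /hr h; apply: le_trans h.
  have -> : k t = eipi4 R * (sg * (Num.sqrt (symdet t) - `|x|))%:C.
    by rewrite /k /ev /lam {1}xsg -mulrBr -rmorphB /= -mulrBr.
  by rewrite csqM csq_eipi4 csqR mul1r exprMn sg2 mul1r.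
have Tb t : 0 < t -> nrm2 (shiftM (@MF R) lam y) t <= e ^+ 2 * nrm2 y t.
  move=> t0; rewrite {1}/nrm2 TyE//= (csqM (k t)) (csqM (k t)) -mulrDr.
  rewrite -[X in _ * X <= _]/(nrm2 y t) nE indicE.
  have [tI|tI] := boolP (t \in I); last by rewrite !mul0r !mulr0.
  have n0 : 0 <= csq (Fpm t) + symdet t.
    by apply: addr_ge0; [exact: csq_ge0|exact/ltW/symdet_gt0].
  by rewrite mul1r ler_wpM2r//; apply: kb; rewrite inE in tI.
have TyM : inM (shiftM (@MF R) lam y).
  apply: (inM_le yM) Tb.
  - apply: cmeasurableD; first by apply: cmeasurableM => //; exact: cmeasurable_Fpm.
    rewrite (_ : (fun _ => _) = (fun t => - lam * (y t).1)).
      by apply: cmeasurableM => //; exact: cmeasurable_cst.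
    by apply/funext => t; rewrite mulNr.
  - apply: cmeasurableD; first by apply: cmeasurableM => //; exact: cmeasurable_Fmp.
    rewrite (_ : (fun _ => _) = (fun t => - lam * (y t).2)).
      by apply: cmeasurableM => //; exact: cmeasurable_cst.
    by apply/funext => t; rewrite mulNr.
have n1 : normM2 (shiftM (@MF R) lam y) <= e ^+ 2 * normM2 y by exact: normM2_le.
have n2 : normM2 y <= c * normM2 (shiftM (@MF R) lam y).
  rewrite -(normM2_eqM (SM _ TyM) yM (TS y yM).1); exact: Sc.
have n0 : 0 < normM2 y.
  (* On the interval cosh (pi t) <= e^(pi (m + r)), so [symdet] is at least q there and the norm of
     y is at least q r. *)
  pose q : R := (2 * expR (pi * (m + r)))^-1.
  have q0 : 0 < q by rewrite invr_gt0 mulr_gt0// expR_gt0.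
  have : \int[mu]_(t in Rpos) (q * \1_I t) <= normM2 y.
    apply: le_Rintegral => //.
    - apply: integrable_EFinZl => //.
      by apply: (integrableS measurableT) => //; exact: integrable_indic_itv.
    - exact: inM_integrable.
    - move=> t Rt; rewrite -[X in _ <= X]/(nrm2 y t) nE mulrC indicE.
      have [tI|_] := boolP (t \in I); last by rewrite !mul0r.
      rewrite !mul1r; apply: (@le_trans _ _ (symdet t)); last by rewrite lerDr csq_ge0.
      move: tI; rewrite inE /I /= in_itv /= => /andP[mt tm].
      have c0 : 0 < 2 * coshR (pi * t) by rewrite mulr_gt0// coshR_gt0.
      have c1 : 0 < 2 * expR (pi * (m + r)) :> R by rewrite mulr_gt0// expR_gt0.
      rewrite lef_pV2 ?posrE// ler_wpM2l//.
      have pt : 0 <= pi * t :> R by rewrite mulr_ge0 ?pi_ge0// ltW// (le_lt_trans m0).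
      have h1 : expR (- (pi * t)) <= expR (pi * t) by rewrite ler_expR; lra.
      apply: (@le_trans _ _ (expR (pi * t))); first by rewrite /coshR; lra.
      by rewrite ler_expR ler_wpM2l ?pi_ge0// ltW.
  apply: lt_le_trans.
  rewrite RintegralZl//; last first.
    by apply: (integrableS measurableT) => //; exact: integrable_indic_itv.
  rewrite mulr_gt0// /Rintegral integral_indic// setIidl//.
  have : 0 < fine (lebesgue_measure I) by rewrite muI.
  exact.
have N0 : 0 <= normM2 (shiftM (@MF R) lam y).
  by apply: Rintegral_ge0 => t _; exact: nrm2_ge0.
have : normM2 y <= K * (e ^+ 2 * normM2 y).
  apply: (le_trans n2); apply: (@le_trans _ _ (K * normM2 (shiftM (@MF R) lam y))).
    by rewrite ler_wpM2r// /K (le_trans (ler_norm c))// lerDl.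
  by rewrite ler_wpM2l// ltW.
move=> h; have : K * e ^+ 2 * normM2 y < normM2 y by rewrite gtr_pMl.
by rewrite ltNge -mulrA h.
Qed.

Lemma segmentP (z : C) :
  (exists tau : R, 0 <= tau <= 1 /\
     z = (1 - tau)%:C * (- (eipi4 R * ((Num.sqrt 2%:R)^-1)%:C))
         + tau%:C * (eipi4 R * ((Num.sqrt 2%:R)^-1)%:C)) <->
  exists2 x : R, x ^+ 2 <= 2^-1 & z = eipi4 R * x%:C.
Proof.
pose s : R := (Num.sqrt 2%:R)^-1.
have s0 : 0 < s by rewrite invr_gt0 sqrtr_gt0.
have s2 : s ^+ 2 = 2^-1 by rewrite exprVn sqr_sqrtr.
have segE (tau : R) : (1 - tau)%:C * (- (eipi4 R * s%:C)) + tau%:C * (eipi4 R * s%:C) =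
    eipi4 R * ((2 * tau - 1) * s)%:C.
  rewrite !rmorphM !rmorphB !rmorphM /= rmorph1; move: (eipi4 R) => E.
  by rewrite (_ : (2 : R)%:C = 2) ?rmorph_nat//; ring.
split => [[tau [/andP[t0 t1] ->]]|[x x2 ->]].
  exists ((2 * tau - 1) * s); last exact: segE.
  by rewrite exprMn s2; nra.
(* Solves x = (2 tau - 1) s for tau. *)
exists ((x / s + 1) / 2); split; last first.
  rewrite segE; congr (_ * _%:C).
  by field; rewrite gt_eqF.
have : `|x| <= s.
  by rewrite -(@ler_pXn2r _ 2) ?nnegrE ?(ltW s0)// real_normK ?num_real// s2.
rewrite ler_norml => /andP[xs1 xs2].
have h1 : -1 <= x / s by rewrite ler_pdivlMr// mulN1r.
have h2 : x / s <= 1 by rewrite ler_pdivrMr// mul1r.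
by apply/andP; split; lra.
Qed.

End Spectrum.

Theorem theorem4p3 (R : realType) :
  spectrumM (@MF R) =
  [set z : R[i] | exists tau : R, 0 <= tau <= 1 /\
     z = (1 - tau)%:C * (- (eipi4 R * ((Num.sqrt 2%:R)^-1)%:C))
         + tau%:C * (eipi4 R * ((Num.sqrt 2%:R)^-1)%:C)].
Proof.
apply/seteqP; split => lam /=.
  move=> hlam; apply/segmentP; apply: contrapT => h; apply: hlam.
  apply: notin_spectrum => x x2; apply/eqP => lx; apply: h; by exists x.
by move=> /segmentP[x x2 ->]; exact: in_spectrum.
Qed.
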